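(* Fix $\nu\in(0,1)$ and assume that $\mathcal P^-_\nu:=\{\theta\in\mathcal P:\mathcal R_{\mathrm{LA}}(\theta)\le1-\nu\}\neq\varnothing$. Then there exist constants $r_\nu>0$, $\varepsilon_\nu>0$, $\lambda_\nu>0$, $c_\nu>0$ with the following property. Let $T>0$, and let $\theta:[0,T]\to\mathcal P^-_\nu$ be an absolutely continuous path satisfying $$\operatorname*{ess\,sup}_{t\in[0,T]}\|\dot\theta(t)\|\le\varepsilon\qquad\text{for some }0<\varepsilon\le\varepsilon_\nu.$$ Let $x(\cdot)$ be the corresponding solution of $$\dot x(t)=F(x(t),\theta(t)),\qquad x(0)=x_0\in\mathcal T.$$ If $$\|x_0-x^\dagger(\theta(0))\|\le\frac{r_\nu}{2c_\nu},\qquad \varepsilon\le\frac{r_\nu}{2c_\nu},$$ then $$\|x(t)-x^\dagger(\theta(t))\|\le c_\nu e^{-\lambda_\nu t}\,\|x_0-x^\dagger(\theta(0))\|+c_\nu\varepsilon\qquad\text{for all }t\in[0,T].$$ In particular, $\|x(t)-x^\dagger(\theta(t))\|\le r_\nu$ for all $t\in[0,T]$.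
   Context: The state space is $\mathcal T=\{x=(L,R,A)\in\mathbb R^3: L\ge0,R\ge0,A\ge0,L+R+A\le1\}$. Parameters are $\theta=(\alpha_L,\alpha_R,\gamma_{LR},\gamma_{RL},\mu_L,\mu_R,\delta_L,\delta_R,\eta,\rho)\in\mathcal P$, where $\mathcal P\subset\mathbb R^{10}$ is a compact convex set all of whose points have strictly positive entries. For $\theta\in\mathcal P$, $$K(\theta)=\begin{pmatrix}\alpha_L&\gamma_{RL}\\ \gamma_{LR}&\alpha_R\end{pmatrix},\quad M(\theta)=\begin{pmatrix}\mu_L&0\\0&\mu_R\end{pmatrix},\quad D(\theta)=\begin{pmatrix}\delta_L&0\\0&\delta_R\end{pmatrix},$$ and $\eta(\theta),\rho(\theta)$ are the last two components. With $v=(L,R)^\top$, $\mathbf 1=(1,1)^\top$, $C=1-\mathbf 1^\top v-A$, the vector field is $$F(x,\theta)=\Bigl(\bigl(CK(\theta)+AD(\theta)-M(\theta)\bigr)v,\ \ \eta(\theta)C-A\,\mathbf 1^\top D(\theta)v-\rho(\theta)A\Bigr).$$ The radical-free branch is $x^\dagger(\theta)=(0,0,A^\dagger(\theta))$ with $A^\dagger(\theta)=\frac{\eta(\theta)}{\eta(\theta)+\rho(\theta)}$ and $C^\dagger(\theta)=\frac{\rho(\theta)}{\eta(\theta)+\rho(\theta)}$. The threshold functional is $\mathcal R_{\mathrm{LA}}(\theta)=\lambda_{\mathrm{PF}}\bigl(M(\theta)^{-1}[C^\dagger(\theta)K(\theta)+A^\dagger(\theta)D(\theta)]\bigr)$,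 where $\lambda_{\mathrm{PF}}$ is the Perron--Frobenius eigenvalue (spectral radius) of a matrix with strictly positive entries. Norms are Euclidean. For every $x_0\in\mathcal T$ the initial value problem has a unique solution on $[0,T]$, and it stays in $\mathcal T$. *)

(* Defs.v *)
From HB Require Import structures.
From mathcomp Require Import all_boot all_order all_algebra.
From mathcomp Require Import complex.
From mathcomp Require Import all_classical all_reals all_analysis ess_sup_inf.

Set Implicit Arguments.
Unset Strict Implicit.
Unset Printing Implicit Defensive.

Import Order.TTheory GRing.Theory Num.Theory.
Import numFieldNormedType.Exports.

Local Open Scope classical_set_scope.
Local Open Scope ring_scope.

(* The library norm `|x| on row vectors is the sup norm, hence [enorm]. *)
Definition enorm (R : realType) (n : nat) (x : 'rV[R]_n) : R :=
  Num.sqrt (\sum_(i < n) x 0 i ^+ 2).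

Definition absolutely_continuous (R : realType) (n : nat) (a b : R)
    (f : R -> 'rV[R]_n) : Prop :=
  forall e : R, 0 < e -> exists2 d : R, 0 < d &
    forall (m : nat) (u v : 'I_m -> R),
      (forall i, a <= u i /\ u i <= v i /\ v i <= b) ->
      trivIset setT (fun i => `]u i, v i[%classic) ->
      \sum_(i < m) (v i - u i) < d ->
      \sum_(i < m) enorm (f (v i) - f (u i)) < e.

(* Largest modulus of a complex eigenvalue; since the spectrum is finite, and
   nonempty when n > 0, this supremum is a maximum. *)
Definition spectral_radius (R : realType) (n : nat) (B : 'M[R]_n) : R :=
  sup [set ComplexField.Normc.normc z | z in
        [set z : R[i] | eigenvalue (map_mx (real_complex R) B) z]].

(* p = (alphaL, alphaR, gammaLR, gammaRL, muL, muR, deltaL, deltaR, eta, rho);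
   the column indices are numerals of the ring structure on 'I_10. *)
Definition alphaL (R : realType) (p : 'rV[R]_10) : R := p 0 0.
Definition alphaR (R : realType) (p : 'rV[R]_10) : R := p 0 1.
Definition gammaLR (R : realType) (p : 'rV[R]_10) : R := p 0 2.
Definition gammaRL (R : realType) (p : 'rV[R]_10) : R := p 0 3.
Definition muL (R : realType) (p : 'rV[R]_10) : R := p 0 4.
Definition muR (R : realType) (p : 'rV[R]_10) : R := p 0 5.
Definition deltaL (R : realType) (p : 'rV[R]_10) : R := p 0 6.
Definition deltaR (R : realType) (p : 'rV[R]_10) : R := p 0 7.
Definition eta (R : realType) (p : 'rV[R]_10) : R := p 0 8.
Definition rho (R : realType) (p : 'rV[R]_10) : R := p 0 9.

Definition Kmx (R : realType) (p : 'rV[R]_10) : 'M[R]_2 :=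
  \matrix_(i < 2, j < 2)
    (nth [::] [:: [:: alphaL p; gammaRL p]; [:: gammaLR p; alphaR p]] i)`_j.

Definition Mmx (R : realType) (p : 'rV[R]_10) : 'M[R]_2 :=
  diag_mx (\row_(i < 2) [:: muL p; muR p]`_i).

Definition Dmx (R : realType) (p : 'rV[R]_10) : 'M[R]_2 :=
  diag_mx (\row_(i < 2) [:: deltaL p; deltaR p]`_i).

(* x = (L, R, A) *)
Definition state_space (R : realType) : set 'rV[R]_3 :=
  [set x | [/\ 0 <= x 0 0, 0 <= x 0 1, 0 <= x 0 2 &
               x 0 0 + x 0 1 + x 0 2 <= 1]].

Definition vector_field (R : realType) (x : 'rV[R]_3) (p : 'rV[R]_10) :
    'rV[R]_3 :=
  let v : 'cV[R]_2 := \col_(i < 2) [:: x 0 0; x 0 1]`_i in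
  let A : R := x 0 2 in
  let one : 'rV[R]_2 := const_mx 1 in
  let C : R := 1 - (one *m v) 0 0 - A in
  let w : 'cV[R]_2 := (C *: Kmx p + A *: Dmx p - Mmx p) *m v in
  let a : R := eta p * C - A * (one *m Dmx p *m v) 0 0 - rho p * A in
  \row_(i < 3) [:: w 0 0; w 1 0; a]`_i.

Definition Adag (R : realType) (p : 'rV[R]_10) : R := eta p / (eta p + rho p).
Definition Cdag (R : realType) (p : 'rV[R]_10) : R := rho p / (eta p + rho p).

Definition xdag (R : realType) (p : 'rV[R]_10) : 'rV[R]_3 :=
  \row_(i < 3) [:: 0; 0; Adag p]`_i.

Definition R_LA (R : realType) (p : 'rV[R]_10) : R :=
  spectral_radius (invmx (Mmx p) *m (Cdag p *: Kmx p + Adag p *: Dmx p)).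

Definition subcritical (R : realType) (P : set 'rV[R]_10) (nu : R) :
    set 'rV[R]_10 :=
  P `&` [set p | R_LA p <= 1 - nu].

(* Classical solution of x' = F(x, theta) on [0, T]. For continuous theta the
   one-sided derivatives at 0 and T follow from continuity of x. *)
Definition is_solution (R : realType) (T : R) (theta : R -> 'rV[R]_10)
    (x0 : 'rV[R]_3) (x : R -> 'rV[R]_3) : Prop :=
  [/\ x 0 = x0,
      {within `[0, T], continuous x} &
      forall t : R, 0 < t < T ->
        is_derive t 1 x (vector_field (x t) (theta t))].

(* derive1 is a junk value where theta is not differentiable, which for an
   absolutely continuous theta happens only on a null subset of [0, T]. *)
Definition ess_speed (R : realType) (T : R) (theta : R -> 'rV[R]_10) : \bar R :=
  ess_sup (mrestr (@lebesgue_measure R) (measurable_itv `[0, T]))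
    (fun t => (enorm (derive1 theta t))%:E).

(* Main.v *)
Require Import Defs.
From HB Require Import structures.
From mathcomp Require Import all_boot all_order all_algebra.
From mathcomp Require Import complex.
From mathcomp Require Import all_classical all_reals all_analysis.
From mathcomp Require Import measurable_realfun ess_sup_inf.
From mathcomp Require Import lra ring.

(** Slow passage along a linearly stable branch, by a quadratic Lyapunov function.

    Write [(L, R, a)] for the deviation of [x = (L, R, A)] from the equilibrium
    [(0, 0, Adag)].  At the equilibrium the field is, to first order, block
    triangular: [(L, R)] is driven by the Metzler matrix [Cdag K + Adag D - M],
    and [a] by [- (eta + rho)] plus a term linear in [L] and [R].  Since the
    off-diagonal entries of the Metzler block are [Cdag gammaRL] and
    [Cdag gammaLR], the weights [gammaLR], [gammaRL] symmetrise it, and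
    [R_LA <= 1 - nu] implies that it remains negative semidefinite for these
    weights after [nu M] is added to it (lemmas [spectral_radius2],
    [R_LA_entries], [linear_part_form]).  Hence
    [gammaLR L^2 + gammaRL R^2 + k a^2], for a small constant [k], decreases
    along the field with frozen parameters in a ball of fixed radius [r] around
    the equilibrium ([frozen_decay], [dlyap_vector_field]).  All constants depend
    only on [nu] and on bounds [m <= p_i <= M] valid on the compact set of
    parameters.

    When the parameters move along an [eps]-Lipschitz path, the Lyapunov function
    changes by an additional term which Young's inequality splits into a small
    multiple of itself and a multiple of [eps^2] ([lyap_drift], [lyap_dini]).
    This gives a differential inequality for the right derivative, valid as long
    as the trajectory stays in the ball; a comparison argument that also provides
    the bootstrap ([dini_comparison]) yields the exponential estimate
    ([lyap_bound]), and taking square roots gives the theorem.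

    It remains to see that an absolutely continuous path whose derivative is
    essentially bounded by [eps] is [eps]-Lipschitz ([ess_speed_lipschitz]).  This
    needs the almost everywhere differentiability of absolutely continuous
    functions.  The total variation of such a function is absolutely continuous
    ([acont_total_variation]), so the function is a difference of two
    nondecreasing absolutely continuous ones ([acont_jordan]); the
    Lebesgue-Stieltjes measure of each is dominated by the Lebesgue measure and
    has a Radon-Nikodym density ([acont_nd_integral]); and the Lebesgue
    differentiation theorem identifies the density with the derivative almost
    everywhere ([acont_derivable]). *)

Import Order.TTheory GRing.Theory Num.Theory.
Import numFieldNormedType.Exports.

Set Implicit Arguments.
Unset Strict Implicit.
Unset Printing Implicit Defensive.

Local Open Scope classical_set_scope.
Local Open Scope ring_scope.

(** * Absolutely continuous functions and their total variation *)

(** Absolute continuity on [[a, b]] of a real function.  As for paths, the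
    disjoint open intervals are indexed by an ordinal and may be empty. *)
Definition acont (R : realType) (a b : R) (f : R -> R) : Prop :=
  forall e : R, 0 < e -> exists2 d : R, 0 < d &
    forall (m : nat) (u v : 'I_m -> R),
      (forall i, a <= u i /\ u i <= v i /\ v i <= b) ->
      trivIset setT (fun i => `]u i, v i[%classic) ->
      \sum_(i < m) (v i - u i) < d ->
      \sum_(i < m) `|f (v i) - f (u i)| < e.

(** The intervals may be indexed by any finite type. *)
Lemma acont_fin (R : realType) (a b : R) (f : R -> R) : acont a b f ->
  forall e : R, 0 < e -> exists2 d : R, 0 < d &
    forall (I : finType) (u v : I -> R),
      (forall i, a <= u i /\ u i <= v i /\ v i <= b) ->
      trivIset setT (fun i => `]u i, v i[%classic) ->
      \sum_i (v i - u i) < d ->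
      \sum_i `|f (v i) - f (u i)| < e.
Proof.
move=> acf e e0; have [d d0 H] := acf e e0; exists d => // I u v uv tuv sd.
have := H #|I| (u \o enum_val) (v \o enum_val) => /=.
rewrite -(big_enum_val (fun i => v i - u i)).
rewrite -(big_enum_val (fun i => `|f (v i) - f (u i)|)).
apply => //.
by move=> i j _ _ ij; apply: enum_val_inj; exact: tuv.
Qed.

Lemma itv_partition_sorted (R : realType) (a b : R) (s : seq R) (i j : nat) :
  itv_partition a b s -> (i <= j)%N -> (j <= size s)%N ->
  nth b (a :: s) i <= nth b (a :: s) j.
Proof.
move=> [sa _] ij js.
have := @sorted_leq_nth _ <=%O le_trans (@lexx _ R) b (a :: s).
apply => //; rewrite ?inE /= ?ltnS // ?(leq_trans ij) //.
by apply: sub_path sa => x y /ltW.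
Qed.

(** Subdividing each of the intervals of a disjoint family gives a disjoint
    family of the same total length, indexed by a sigma type. *)
Lemma acont_variation (R : realType) (a b : R) (f : R -> R) : acont a b f ->
  forall e : R, 0 < e -> exists2 d : R, 0 < d &
    forall (m : nat) (u v : 'I_m -> R) (s : 'I_m -> seq R),
      (forall i, a <= u i /\ u i <= v i /\ v i <= b) ->
      (forall i, itv_partition (u i) (v i) (s i)) ->
      trivIset setT (fun i => `]u i, v i[%classic) ->
      \sum_(i < m) (v i - u i) < d ->
      \sum_(i < m) variation (u i) (v i) f (s i) < e.
Proof.
move=> acf e e0; have [d d0 H] := acont_fin acf e0; exists d => //.
move=> m u v s uv ps tuv sd.
pose I : finType := {i : 'I_m & 'I_(size (s i))}.
pose U (x : I) := nth (v (tag x)) (u (tag x) :: s (tag x)) (tagged x).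
pose V (x : I) := nth (v (tag x)) (u (tag x) :: s (tag x)) (tagged x).+1.
have UV x : U x <= V x.
  by apply: itv_partition_sorted (ps _) _ _ => //; exact: ltn_ord.
have uU x : u (tag x) <= U x.
  by apply: itv_partition_nth_ge (ps _); rewrite ltnS ltnW.
have vV x : V x <= v (tag x).
  by apply: itv_partition_nth_le (ps _); rewrite ltnS.
have sumI (g : R -> R) : \sum_(x : I) `|g (V x) - g (U x)| =
    \sum_(i < m) variation (u i) (v i) g (s i).
  under [RHS]eq_bigr do rewrite /variation big_mkord.
  by rewrite (sig_big_dep xpredT (fun i => xpredT) (fun i (j : 'I_(size (s i))) =>
     `|g (nth (v i) (u i :: s i) j.+1) - g (nth (v i) (u i :: s i) j)|)).
rewrite -(sumI f); apply: H.
- move=> x; have [au [_ vb]] := uv (tag x); split; first exact: le_trans au (uU x).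
  by split; [exact: UV | exact: le_trans (vV x) vb].
- move=> [i j] [i' j'] _ _ /= [z [/=]]; rewrite !in_itv /= => /andP[z1 z2] /andP[z3 z4].
  have ii' : i = i'.
    apply: (tuv i i') => //; exists z; split; rewrite /= in_itv /=.
      rewrite (le_lt_trans (uU (Tagged (fun i => 'I_(size (s i))) j)) z1).
      by rewrite (lt_le_trans z2 (vV (Tagged (fun i => 'I_(size (s i))) j))).
    rewrite (le_lt_trans (uU (Tagged (fun i => 'I_(size (s i))) j')) z3).
    by rewrite (lt_le_trans z4 (vV (Tagged (fun i => 'I_(size (s i))) j'))).
  subst i'; congr (Tagged _ _); apply/val_inj => /=.
  move: z1 z2 z3 z4; rewrite /U /V /= => z1 z2 z3 z4.
  case: (ltngtP j j') => // jj'.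
  - have := itv_partition_sorted (ps i) jj' (ltnW (ltn_ord j')).
    by rewrite /= leNgt (lt_trans z3 z2).
  - have := itv_partition_sorted (ps i) jj' (ltnW (ltn_ord j)).
    by rewrite /= leNgt (lt_trans z1 z4).
- apply: le_lt_trans sd; rewrite le_eqVlt; apply/orP; left; apply/eqP.
  transitivity (\sum_(x : I) `|id (V x) - id (U x)|).
    by apply: eq_bigr => x _; rewrite ger0_norm// subr_ge0.
  rewrite (sumI id); apply: eq_bigr => i _.
  by apply: nondecreasing_variation => // x y _ _.
Qed.

Lemma acont_total_variation (R : realType) (a b : R) (f : R -> R) :
  acont a b f ->
  forall e : R, 0 < e -> exists2 d : R, 0 < d &
    forall (m : nat) (u v : 'I_m -> R),
      (forall i, a <= u i /\ u i <= v i /\ v i <= b) ->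
      trivIset setT (fun i => `]u i, v i[%classic) ->
      \sum_(i < m) (v i - u i) < d ->
      (\sum_(i < m) total_variation (u i) (v i) f <= e%:E)%E.
Proof.
move=> acf e e0; have [d d0 H] := acont_variation acf e0; exists d => //.
move=> m u v uv tuv sd.
have d0' i : v i - u i < d.
  apply: le_lt_trans sd; rewrite (bigD1 i) //= lerDl sumr_ge0 // => j _.
  by rewrite subr_ge0; have [_ []] := uv j.
(* each single variation is at most [e], hence finite *)
have TVe i : (total_variation (u i) (v i) f <= e%:E)%E.
  apply: ge_ereal_sup => _ [_ [s ps <-] <-]; rewrite lee_fin ltW //.
  have := H 1%N (fun=> u i) (fun=> v i) (fun=> s); rewrite !big_ord1; apply => //.
  by move=> j k _ _; rewrite !ord1.
have TVfin i : total_variation (u i) (v i) f \is a fin_num.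
  rewrite ge0_fin_numE; last by apply: total_variation_ge0; have [_ []] := uv i.
  exact: le_lt_trans (TVe i) (ltry _).
apply/lee_addgt0Pr => r r0.
have rm : 0 < r / m.+1%:R by rewrite divr_gt0.
(* subdivisions that realise each variation up to [r / (m + 1)] *)
have /choice[s Hs] : forall i, exists s, itv_partition (u i) (v i) s /\
   (total_variation (u i) (v i) f <= (variation (u i) (v i) f s + r / m.+1%:R)%:E)%E.
  move=> i; have [_ [_ [s ps <-] <-] hs] := ub_ereal_sup_adherent rm (TVfin i).
  by exists s; split=> //; rewrite EFinD -leeBlDr // ltW.
apply: (@le_trans _ _ (\sum_(i < m) (variation (u i) (v i) f (s i) + r / m.+1%:R)%:E)%E).
  by apply: lee_sum => i _; have [] := Hs i.
rewrite sumEFin -EFinD lee_fin big_split /= lerD //.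
  by apply/ltW/H => // i; have [] := Hs i.
rewrite sumr_const card_ord -[leLHS]mulr_natr mulrAC ler_pdivrMr //.
by rewrite ler_wpM2l ?(ltW r0) // ler_nat.
Qed.

Lemma acont_uniform (R : realType) (a b : R) (f : R -> R) : acont a b f ->
  forall e : R, 0 < e -> exists2 d : R, 0 < d &
    forall u v, a <= u -> u <= v -> v <= b -> v - u < d -> `|f v - f u| < e.
Proof.
move=> acf e e0; have [d d0 H] := acf e e0; exists d => // u v au uv vb vud.
have := H 1%N (fun=> u) (fun=> v); rewrite !big_ord1; apply=> //.
by move=> i j _ _ _; rewrite !ord1.
Qed.

Lemma acontB (R : realType) (a b : R) (f g : R -> R) :
  acont a b f -> acont a b g -> acont a b (f \- g).
Proof.
move=> acf acg e e0; have e20 : 0 < e / 2 by rewrite divr_gt0.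
have [d1 d10 H1] := acf _ e20; have [d2 d20 H2] := acg _ e20.
exists (Num.min d1 d2); first by rewrite lt_min d10.
move=> m u v uv tuv; rewrite lt_min => /andP[sd1 sd2].
rewrite (splitr e); apply: le_lt_trans (ltrD (H1 m u v uv tuv sd1) (H2 m u v uv tuv sd2)).
rewrite -big_split /=; apply: ler_sum => i _.
have -> : f (v i) - g (v i) - (f (u i) - g (u i)) =
  (f (v i) - f (u i)) - (g (v i) - g (u i)) by ring.
exact: ler_normB.
Qed.

Lemma acont_total_variation_fin (R : realType) (a b : R) (f : R -> R) :
  acont a b f -> forall x, a <= x -> x <= b -> total_variation a x f \is a fin_num.
Proof.
move=> acf; have [d d0 H] := acont_total_variation acf ltr01.
(* the variation over an interval of length [d / 2] is at most 1; induction on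
   the number of such intervals *)
have d20 : 0 < d / 2 by rewrite divr_gt0.
suff P n x : a <= x -> x <= b -> x - a <= n%:R * (d / 2) ->
    total_variation a x f \is a fin_num.
  move=> x ax xb; have [n Hn] : exists n, (x - a) / (d / 2) <= n%:R.
    exists (Num.bound ((x - a) / (d / 2))); apply/ltW.
    by rewrite archi_boundP // divr_ge0 ?subr_ge0 // ltW.
  by apply: (P n) => //; rewrite -ler_pdivrMr.
elim: n x => [|n IH] x ax xb.
  rewrite mul0r subr_le0 => xa.
  have -> : x = a by apply/eqP; rewrite eq_le xa ax.
  by rewrite total_variationxx.
move=> xn; pose y := Num.max a (x - d / 2).
have ay : a <= y by rewrite le_max lexx.
have yx : y <= x by rewrite ge_max ax /= gerBl ltW.
rewrite (total_variationD f ay yx) fin_numD; apply/andP; split.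
  apply: IH => //; first exact: le_trans yx xb.
  rewrite /y; case: (leP a (x - d / 2)) => _.
    by move: xn; rewrite -natr1 mulrDl mul1r; lra.
  by rewrite subrr mulr_ge0 // ltW.
rewrite ge0_fin_numE ?total_variation_ge0 //.
have := H 1%N (fun=> y) (fun=> x); rewrite !big_ord1 => H1.
apply: (le_lt_trans (H1 _ _ _)) => //; last by rewrite ltry.
  by move=> i j _ _ _; rewrite !ord1.
have : x - d / 2 <= y by rewrite le_max lexx orbT.
by clear -d0; lra.
Qed.

(** Jordan decomposition: [F] is the total variation from [a], and [G] is
    [F - f]. *)
Lemma acont_jordan (R : realType) (a b : R) (f : R -> R) : acont a b f ->
  exists F G : R -> R, [/\ acont a b F /\ acont a b G,
    (forall s t, a <= s -> s <= t -> t <= b -> F s <= F t),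
    (forall s t, a <= s -> s <= t -> t <= b -> G s <= G t) &
    forall t, f t = F t - G t].
Proof.
move=> acf; pose V t := fine (total_variation a t f).
have VB s t : a <= s -> s <= t -> t <= b ->
    total_variation s t f = (V t - V s)%:E.
  move=> as_ st tb; have at_ := le_trans as_ st; have sb := le_trans st tb.
  have Ft := acont_total_variation_fin acf at_ tb.
  have Fs := acont_total_variation_fin acf as_ sb.
  rewrite EFinB /V !fineK // (total_variationD f as_ st) addeAC subee ?add0e //.
have Vmono s t : a <= s -> s <= t -> t <= b -> `|f t - f s| <= V t - V s.
  move=> as_ st tb; rewrite -lee_fin -VB //; exact: total_variation_ge.
have acV : acont a b V.
  move=> e e0; have e20 : 0 < e / 2 by rewrite divr_gt0.
  have [d d0 H] := acont_total_variation acf e20; exists d => // m u v uv tuv sd.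
  apply: (@le_lt_trans _ _ (e / 2)); last by rewrite ltr_pdivrMr // ltr_pMr // ltr1n.
  rewrite -lee_fin; apply: le_trans (H m u v uv tuv sd).
  rewrite -sumEFin; apply: lee_sum => i _; have [au [ui vb]] := uv i.
  by rewrite VB // lee_fin ger0_norm // (le_trans _ (Vmono _ _ _ _ _)).
exists V, (V \- f); split.
- by split=> //; exact: acontB.
- by move=> s t as_ st tb; rewrite -subr_ge0 (le_trans _ (Vmono _ _ as_ st tb)).
- move=> s t as_ st tb /=; have := Vmono _ _ as_ st tb.
  by have := ler_norm (f t - f s); lra.
- by move=> t /=; rewrite opprB addrC subrK.
Qed.

(** * The density of a nondecreasing absolutely continuous function *)

(** The point of [[a, b]] nearest to [t], when [a <= b]. *)
Definition clamp (R : realType) (a b t : R) : R := Num.max a (Num.min b t).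

Lemma clamp_ge (R : realType) (a b t : R) : a <= clamp a b t.
Proof. by rewrite le_max lexx. Qed.

Lemma clamp_le (R : realType) (a b t : R) : a <= b -> clamp a b t <= b.
Proof. by move=> ab; rewrite ge_max ab ge_min lexx. Qed.

Lemma clamp_id (R : realType) (a b t : R) : a <= t -> t <= b -> clamp a b t = t.
Proof. by move=> at_ tb; rewrite /clamp min_r // max_r. Qed.

Lemma clamp_mono (R : realType) (a b s t : R) : s <= t -> clamp a b s <= clamp a b t.
Proof. by move=> st; rewrite /clamp le_max2 // le_min2. Qed.

Lemma clamp_lip (R : realType) (a b s t : R) : s <= t ->
  clamp a b t - clamp a b s <= t - s.
Proof.
move=> st; have st' : Num.min b s <= Num.min b t by rewrite le_min2.
apply: (@le_trans _ _ (Num.min b t - Num.min b s)).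
  by rewrite /clamp; case: (leP a (Num.min b s)) => ?;
     case: (leP a (Num.min b t)) => ?; lra.
by case: (leP b s) => ?; case: (leP b t) => ?; lra.
Qed.

Lemma clamp_itv (R : realType) (a b l r : R) :
  `]clamp a b l, clamp a b r[ `<=` `]l, r[.
Proof.
move=> x /=; rewrite !in_itv /= /clamp gt_max lt_max gt_min lt_min.
move=> /andP[/andP[ax bl] /orP[xa|/andP[xb ->]]]; first by rewrite (lt_gtF ax) in xa.
by move: bl; rewrite (lt_gtF xb) => /= ->.
Qed.

Section ac_measure.
Context {R : realType} (a b : R) (F : R -> R).
Hypothesis ab : a <= b.
Hypothesis acF : acont a b F.
Hypothesis ndF : forall s t, a <= s -> s <= t -> t <= b -> F s <= F t.

(* [F] extended by constants outside [[a, b]] *)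
Let G t := F (clamp a b t).

Let ndG : {homo G : x y / x <= y}.
Proof.
by move=> x y xy; apply: ndF; [exact: clamp_ge | exact: clamp_mono | exact: clamp_le].
Qed.

Let rcG : right_continuous G.
Proof.
move=> x; apply/cvgrPdist_lt => e e0; have [d d0 H] := acont_uniform acF e0.
near=> y; rewrite distrC; apply: H; [exact: clamp_ge| |exact: clamp_le|].
  by apply: clamp_mono; near: y; exact: nbhs_right_ge.
apply: le_lt_trans (clamp_lip a b _) _.
  by near: y; exact: nbhs_right_ge.
by rewrite ltrBlDr addrC; near: y; apply: nbhs_right_lt; rewrite ltrDl.
Unshelve. all: by end_near. Qed.

HB.instance Definition _ := isCumulative.Build R _ R G ndG rcG.

Let lsG : {measure set (measurableTypeR R) -> \bar R} :=
  lebesgue_stieltjes_measure G.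

Let lsG_oc (s t : R) : s <= t -> lsG `]s, t]%classic = (G t - G s)%:E.
Proof.
move=> st; rewrite /lsG /= /lebesgue_stieltjes_measure /measure_extension.
rewrite measurable_mu_extE /=; first by rewrite wlength_itv_bnd.
exact: is_ocitv.
Qed.

(* the Lebesgue-Stieltjes measure of [G] does not charge Lebesgue null sets *)
Let lsG_null N : measurable N -> N `<=` `[a, b] -> lebesgue_measure N = 0%E ->
  lsG N = 0%E.
Proof.
move=> mN Nab N0; apply/eqP; rewrite eq_le measure_ge0 andbT.
apply/lee_addgt0Pr => e e0; rewrite add0e.
have [d d0 H] := acF e0.
have [|U [oU NU UN]] := lebesgue_regularity_outer mN _ d0.
  by rewrite [X in (X < _)%E]N0 ltry.
(* bounding the open set makes its components bounded intervals *)
pose U' := U `&` `]a - 1, b + 1[%classic.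
have oU' : open U' by apply: openI => //; exact: interval_open.
have mU' : measurable U' by exact: open_measurable.
have NU' : N `<=` U'.
  move=> x Nx; split; first exact: NU.
  by have := Nab x Nx; rewrite /= !in_itv /= => /andP[? ?]; apply/andP; split; lra.
have U'd : (lebesgue_measure U' < d%:E)%E.
  apply: le_lt_trans UN; apply: (@le_trans _ _ (lebesgue_measure U)).
    by apply: le_measure; rewrite ?inE //; [exact: open_measurable|exact: subIsetl].
  rewrite -[X in lebesgue_measure X](setDKU NU).
  apply: le_trans (measureU2 _ _ _) _ => //.
    by apply: measurableD => //; exact: open_measurable.
  by rewrite [X in (_ + X)%E]N0 adde0.
pose I := open_disjoint_itv oU'.
have mI k : measurable (I k) by apply: open_measurable; exact: open_disjoint_itv_open.
have tI : trivIset setT I by exact: open_disjoint_itv_trivIset.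
have UI : U' = \bigcup_k I k by exact: open_disjoint_itv_bigcup.
have IU k : I k `<=` U' by rewrite UI; exact: bigcup_sup.
have Ilb k : has_lbound (I k).
  exists (a - 1) => x /IU[_] /=; rewrite in_itv /= => /andP[/ltW]//.
have Iub k : has_ubound (I k).
  exists (b + 1) => x /IU[_] /=; rewrite in_itv /= => /andP[_ /ltW]//.
pose l k := inf (I k); pose r k := sup (I k).
have IE k : I k = `]l k, r k[%classic.
  have := interval_bounded_interior (@open_disjoint_itv_is_interval _ _ oU' k) (Ilb k) (Iub k).
  have /interior_id -> := @open_disjoint_itv_open _ _ oU' k.
  rewrite -/I => ->; apply/seteqP; split => x /=; rewrite in_itv //.
have lr k : l k <= r k.
  have [I0|/set0P[x Ix]] := eqVneq (I k) set0; first by rewrite /l /r I0 inf0 sup0.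
  by apply: le_trans (ge_inf (Ilb k) Ix) (ub_le_sup (Iub k) Ix).
have lamI k : lebesgue_measure (I k) = (r k - l k)%:E.
  rewrite IE lebesgue_measure_itv /= lte_fin; case: ltP => // rl.
  have rlE : r k = l k by apply/eqP; rewrite eq_le rl lr.
  by rewrite rlE subrr.
have lsI k : (lsG (I k) <= (G (r k) - G (l k))%:E)%E.
  rewrite -lsG_oc // IE; apply: le_measure; rewrite ?inE //.
  by apply: subset_itvl; rewrite bnd_simp.
apply: (@le_trans _ _ (lsG U')).
  by apply: le_measure; rewrite ?inE.
rewrite UI measure_bigcup //.
apply: lime_le; first by apply: is_cvg_nneseries => k _ _; exact: measure_ge0.
near=> n; rewrite big_mkcond /=.
under eq_bigr do rewrite in_setT.
rewrite big_mkord; apply: (@le_trans _ _ (\sum_(k < n) (G (r k) - G (l k))%:E)%E).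
  by apply: lee_sum => k _; exact: lsI.
rewrite sumEFin lee_fin ltW //.
have tI' : trivIset setT (fun k : 'I_n => `]clamp a b (l k), clamp a b (r k)[%classic).
  move=> i j _ _ [x [xi xj]]; apply/val_inj/tI => //.
  by exists x; rewrite !IE; split; [exact: (clamp_itv xi)|exact: (clamp_itv xj)].
have := H n (fun k => clamp a b (l k)) (fun k => clamp a b (r k)).
move=> /(_ _ tI' _) H'; apply: le_lt_trans (H' _ _).
- by apply: ler_sum => k _; exact: ler_norm.
- by move=> k; rewrite clamp_ge clamp_le //; split => //; split=> //; exact: clamp_mono.
- rewrite -lte_fin; apply: le_lt_trans U'd.
  apply: (@le_trans _ _ (\sum_(k < n) lebesgue_measure (I k))%E).
    rewrite [leRHS](eq_bigr (fun k : 'I_n => (r k - l k)%:E)); last first.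
      by move=> k _; exact: lamI.
    by rewrite sumEFin lee_fin; apply: ler_sum => k _; exact: clamp_lip.
  rewrite -measure_bigsetU // UI; apply: le_measure; rewrite ?inE.
  + by apply: (@bigsetU_measurable _ (measurableTypeR R)) => k _; exact: mI.
  + by apply: (@bigcupT_measurable _ (measurableTypeR R)) => k; exact: mI.
  + by rewrite -bigcup_mkord; apply: bigcup_subset.
- by move=> k _; exact: mI.
Unshelve. all: by end_near. Qed.

(** [F] is the integral of the Radon-Nikodym density of its Lebesgue-Stieltjes
    measure. *)
Lemma acont_nd_integral : exists g : R -> R,
  (lebesgue_measure : {measure set (measurableTypeR R) -> \bar R}).-integrable
     setT (EFin \o g) /\
  forall t, a <= t -> t <= b ->
    F t - F a = \int[lebesgue_measure]_(x in `]a, t]) g x.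
Proof.
have mD : measurable (`]a, b]%classic : set (measurableTypeR R)).
  exact: measurable_itv.
have Doo : (lsG `]a, b]%classic < +oo)%E by rewrite lsG_oc // ltry.
pose nu : {finite_measure set (measurableTypeR R) -> \bar R} := mfrestr mD Doo.
pose lam : {sigma_finite_measure set (measurableTypeR R) -> \bar R} :=
  @lebesgue_measure R.
have nulam : charge_of_finite_measure nu `<< lam.
  move=> N N0 A mA AN; rewrite /nu /= /mfrestr /mrestr.
  have mAD : measurable (A `&` `]a, b]%classic) by exact: measurableI.
  apply: lsG_null => //.
    by move=> x [_] /=; rewrite !in_itv /= => /andP[/ltW -> ->].
  by apply: N0 => //; apply: subset_trans AN; exact: subIsetl.
have gfin x := Radon_Nikodym_fin_num x nulam.
have gE : EFin \o (fine \o Radon_Nikodym (charge_of_finite_measure nu) lam) =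
    Radon_Nikodym (charge_of_finite_measure nu) lam.
  by apply/funext => x /=; rewrite fineK.
exists (fine \o Radon_Nikodym (charge_of_finite_measure nu) lam); split.
  by rewrite gE; exact: Radon_Nikodym_integrable.
move=> t at_ tb; have nuE : nu `]a, t]%classic = (F t - F a)%:E.
  rewrite /nu /= /mfrestr /mrestr setIidl; last by apply: subset_itvl; rewrite bnd_simp.
  by rewrite [LHS]lsG_oc // /G !clamp_id.
rewrite /Rintegral -[LHS]/(fine (F t - F a)%:E) -nuE; congr fine.
have -> : nu `]a, t]%classic = charge_of_finite_measure nu `]a, t]%classic by [].
rewrite (Radon_Nikodym_integral nulam); last exact: measurable_itv.
by apply: eq_integral => x _; rewrite -[RHS]/((EFin \o _) x) gE.
Qed.

End ac_measure.

(** * Almost everywhere differentiability and Lipschitz bounds *)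

(** An absolutely continuous function is the integral of an integrable one. *)
Lemma acont_integral (R : realType) (a b : R) (f : R -> R) :
  a <= b -> acont a b f ->
  exists g : R -> R,
    lebesgue_measure.-integrable [set: R] (EFin \o g) /\
    forall t, a <= t -> t <= b ->
      f t = f a + \int[lebesgue_measure]_(x in `]a, t]) g x.
Proof.
move=> ab acf; have [F [G [[acF acG] ndF ndG fE]]] := acont_jordan acf.
have [g1 [ig1 Fg1]] := acont_nd_integral ab acF ndF.
have [g2 [ig2 Gg2]] := acont_nd_integral ab acG ndG.
exists (g1 \- g2); split.
  have -> : EFin \o (g1 \- g2) = ((EFin \o g1) \- (EFin \o g2))%E by [].

  exact: integrableB.
move=> t at_ tb; rewrite RintegralB //.
- by rewrite -Fg1 // -Gg2 // !fE; ring.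
- exact: integrableS ig1.
- exact: integrableS ig2.
Qed.

(** Lebesgue differentiation, in terms of the primitive [f] of [g]. *)
Lemma acont_derivable (R : realType) (a b : R) (f g : R -> R) :
  lebesgue_measure.-integrable [set: R] (EFin \o g) ->
  (forall t, a <= t -> t <= b ->
      f t = f a + \int[lebesgue_measure]_(x in `]a, t]) g x) ->
  {ae lebesgue_measure, forall t, a < t < b ->
     derivable f t 1 /\ 'D_1 f t = g t}.
Proof.
move=> ig fE.
have igy (y : R) : lebesgue_measure.-integrable `]a, y] (EFin \o g).
  exact: integrableS ig.
have lg : locally_integrable [set: R] g.
  apply: open_integrable_locally => //; exact: openT.
have := FTC1 igy lg => -[].
move=> N [mN N0 sN]; exists N; split=> //; apply: subset_trans sN => t /= H1 H2.
apply: H1 => /andP[at_ tb].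
have [|dF DF] := H2; first by rewrite lte_fin.
have Ff : {near t, (cst (f a) + (fun x => \int[lebesgue_measure]_(y in `]a, x]) g y))
    =1 f}.
  near=> x; rewrite /= [RHS]fE //.
    by apply: ltW; near: x; exact: lt_nbhsr.
  by apply: ltW; near: x; exact: lt_nbhsl.
have dcF : derivable (cst (f a) + (fun x => \int[lebesgue_measure]_(y in `]a, x]) g y)) t 1.
  by apply: derivableD; [exact: derivable_cst|exact: dF].
split; first exact: near_eq_derivable Ff dcF.
rewrite -(near_eq_derive _ Ff) deriveD; [|exact: derivable_cst|exact: dF].
by rewrite derive_cst add0r -derive1E.
Unshelve. all: by end_near. Qed.

Lemma integral_lipschitz (R : realType) (a b e : R) (f g : R -> R) :
  lebesgue_measure.-integrable [set: R] (EFin \o g) ->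
  (forall t, a <= t -> t <= b ->
      f t = f a + \int[lebesgue_measure]_(x in `]a, t]) g x) -> 0 <= e ->
  {ae lebesgue_measure, forall t, a < t < b -> `|g t| <= e} ->
  forall s t, a <= s -> s <= t -> t <= b -> `|f t - f s| <= e * (t - s).
Proof.
move=> ig fE e0 ge s t as_ st tb.
have Igo (D : set R) : measurable D -> lebesgue_measure.-integrable D (EFin \o g).
  by move=> mD; exact: integrableS ig.
rewrite (fE t) ?(le_trans as_ st) // (fE s) ?(le_trans st tb) //.
rewrite (_ : _ - _ = \int[lebesgue_measure]_(x in `]s, t]) g x); last first.
  rewrite opprD addrACA subrr add0r.
  by apply: Rintegral_itvB; rewrite ?bnd_simp //; exact: Igo.
rewrite -Rintegral_itv_bndo_bndc; last exact: Igo.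
rewrite -lee_fin EFin_normr_Rintegral //; last exact: Igo.
apply: (@le_trans _ _ (\int[lebesgue_measure]_(x in `]s, t[) `|(g x)%:E|)%E).
  by apply: le_abse_integral => //; exact: measurable_int (Igo _ _).
apply: (@le_trans _ _ (\int[lebesgue_measure]_(x in `]s, t[) (cst e%:E) x)%E).
  apply: ae_ge0_le_integral => //.
  - by apply: measurableT_comp => //; exact: measurable_int (Igo _ _).
  - case: ge => N [mN N0 sN]; exists N; split=> //; apply: subset_trans sN => x /= H1 H2.
    apply: H1; rewrite in_itv /= => /andP[sx xt]; rewrite lee_fin; apply: H2.
    by rewrite (le_lt_trans as_ sx) (lt_le_trans xt tb).
rewrite integral_cst // [X in (_ * X <= _)%E]lebesgue_measure_itv /= lte_fin.
by case: ltP => [_|ts]; rewrite ?mule0 ?lee_fin ?mulr_ge0 ?subr_ge0 // -EFinM.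
Qed.

Lemma coord_le_enorm (R : realType) (n : nat) (x : 'rV[R]_n) (i : 'I_n) :
  `|x 0 i| <= enorm x.
Proof.
rewrite -sqrtr_sqr; apply: ler_wsqrtr.
by rewrite (bigD1 i) //= lerDl sumr_ge0 // => j _; exact: sqr_ge0.
Qed.

(** An absolutely continuous path whose speed is essentially bounded by [e]
    has [e]-Lipschitz coordinates.  The essential bound concerns [derive1 th],
    which is meaningful only where all the coordinates are differentiable, that
    is almost everywhere. *)
Lemma ess_speed_lipschitz (R : realType) (T e : R) (th : R -> 'rV[R]_10) :
  0 < T -> 0 <= e -> absolutely_continuous 0 T th ->
  (ess_speed T th <= e%:E)%E ->
  forall i s t, 0 <= s -> s <= t -> t <= T -> `|th t 0 i - th s 0 i| <= e * (t - s).
Proof.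
move=> T0 e0 acth /ess_supP spd i.
have ac j : acont 0 T (fun t => th t 0 j).
  move=> r r0; have [d d0 H] := acth r r0; exists d => // m u v uv tuv sd.
  apply: le_lt_trans (H m u v uv tuv sd); apply: ler_sum => k _.
  by have := coord_le_enorm (th (v k) - th (u k)) j; rewrite !mxE.
have /choice[g Hg] : forall j, exists g : R -> R,
    lebesgue_measure.-integrable [set: R] (EFin \o g) /\
    forall t, 0 <= t -> t <= T ->
      th t 0 j = th 0 0 j + \int[lebesgue_measure]_(x in `]0, t]) g x.
  by move=> j; have [g Hg] := acont_integral (ltW T0) (ac j); exists g.
apply: (integral_lipschitz (Hg i).1 (Hg i).2 e0).
have FF : Filter (almost_everywhere (@lebesgue_measure R)).
  exact: ae_filter_ringOfSetsType.
have dth : {ae lebesgue_measure, forall t, forall j : 'I_10, 0 < t < T ->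
     derivable (fun t => th t 0 j) t 1 /\ 'D_1 (fun t => th t 0 j) t = g j t}.
  by apply: filter_forall => j; exact: acont_derivable (Hg j).1 (Hg j).2.
have spd' : {ae lebesgue_measure, forall t, 0 < t < T -> enorm (derive1 th t) <= e}.
  case: spd => N [mN N0 sN]; exists (N `&` `[0, T]%classic); split=> //.
    exact: measurableI.
  move=> t /= /not_implyP [/andP[t0 tT] H]; split.
    by apply: sN => /=; rewrite lee_fin.
  by rewrite /= in_itv /= !ltW.
apply: filterS2 dth spd' => t dt st t0T.
have dtht : derivable th t 1.
  by apply/derivable_mxP => k j; rewrite (ord1 k); exact: (dt j t0T).1.
have := le_trans (coord_le_enorm (derive1 th t) i) (st t0T).
by rewrite derive1E (derive_mx dtht) mxE (dt i t0T).2.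
Qed.

(** * A comparison principle *)

(** Comparison with the linear equation [y' = - l y + b], for a continuous
    function which satisfies the differential inequality, for right difference
    quotients, only where it is below [B].  If the solution of the equation that
    starts at [phi 0] stays below [B], so does [phi], and the restriction is
    harmless. *)
Lemma dini_comparison (R : realType) (T l b B : R) (phi : R -> R) :
  0 < l -> 0 <= b -> 0 <= phi 0 -> phi 0 + b / l < B ->
  (forall t, 0 <= t <= T -> forall e, 0 < e -> exists2 d, 0 < d &
     forall s, 0 <= s <= T -> `|s - t| < d -> `|phi s - phi t| < e) ->
  (forall t, 0 < t < T -> phi t < B -> forall e, 0 < e -> exists2 d, 0 < d &
     forall h, 0 < h < d -> phi (t + h) <= phi t + h * (- l * phi t + b + e)) ->
  forall t, 0 <= t <= T -> phi t <= expR (- l * t) * phi 0 + b / l.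
Proof.
move=> l0 b0 p0 pB pc pd t1 /andP[t10 t1T]; apply/ler_addgt0Pr => e e0.
pose e1 := Num.min (e / 2) ((B - (phi 0 + b / l)) / 4).
have e10 : 0 < e1 by rewrite lt_min !divr_gt0 // subr_gt0.
have e1e : e1 <= e / 2 by rewrite ge_min lexx.
have e1B : e1 <= (B - (phi 0 + b / l)) / 4 by rewrite ge_min lexx orbT.
(* a barrier slightly above the solution, for the right-hand side [b + l e1];
   it stays below [B] *)
pose psi t := expR (- l * t) * (phi 0 + e1) + b / l + e1.
have expl1 t : 0 <= t -> expR (- l * t) <= 1.
  by move=> tge0; rewrite -expR0 ler_expR mulNr oppr_le0 mulr_ge0 // ltW.
have psiB t : 0 <= t -> psi t < B.
  move=> tge0; rewrite /psi.
  have : expR (- l * t) * (phi 0 + e1) <= phi 0 + e1.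
    by rewrite ler_piMl ?expl1 // addr_ge0 // ltW.
  lra.
(* from [1 + y <= exp y] *)
have psi_step t h : 0 <= h -> psi t + h * (- l * psi t + b + l * e1) <= psi (t + h).
  move=> h0; have E : psi t + h * (- l * psi t + b + l * e1) =
      expR (- l * t) * (1 + - l * h) * (phi 0 + e1) + b / l + e1.
    rewrite /psi; field; exact: lt0r_neq0.
  rewrite E /psi [- l * (t + h)]mulrDr expRD -!mulrA !lerD2r ler_wpM2l ?expR_ge0 //.
  by rewrite ler_wpM2r ?addr_ge0 ?(ltW e10) // expR_ge1Dx.
have psic t : 0 <= t <= T -> forall r, 0 < r -> exists2 d, 0 < d &
     forall s, 0 <= s <= T -> `|s - t| < d -> `|psi s - psi t| < r.
  move=> _ r r0.
  have : {for t, continuous psi}.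
    apply: continuousD; last exact: cst_continuous.
    apply: continuousD; last exact: cst_continuous.
    apply: continuousM; last exact: cst_continuous.
    apply: (@continuous_comp _ _ _ (fun t => - l * t) expR).
      by apply: continuousM; [exact: cst_continuous|exact: id].
    exact: continuous_expR.
  move=> /cvgrPdist_lt /(_ r r0) [d /= d0 H]; exists d => // s _ sd.
  by rewrite distrC; apply: H; rewrite /= distrC.
(* continuity of the gap between [phi] and the barrier *)
have gapc t : 0 <= t <= T -> forall r, 0 < r -> exists2 d, 0 < d &
     forall s, 0 <= s <= T -> `|s - t| < d ->
       `|(phi s - psi s) - (phi t - psi t)| < r.
  move=> tT r r0; have r20 : 0 < r / 2 by rewrite divr_gt0.
  have [d1 d10 H1] := pc t tT _ r20; have [d2 d20 H2] := psic t tT _ r20.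
  exists (Num.min d1 d2); first by rewrite lt_min d10.
  move=> s sT; rewrite lt_min => /andP[sd1 sd2].
  have -> : phi s - psi s - (phi t - psi t) = (phi s - phi t) - (psi s - psi t).
    by ring.
  by rewrite (splitr r) (le_lt_trans (ler_normB _ _)) // ltrD ?H1 ?H2.
suff : phi t1 <= psi t1.
  rewrite /psi mulrDr => h; apply: le_trans h _.
  have : expR (- l * t1) * e1 <= e1 by rewrite ler_piMl ?expl1 // ltW.
  lra.
rewrite leNgt; apply/negP => gap1.
(* [s] is the last time before [t1] at which [phi <= psi] *)
pose A := [set t | 0 <= t <= t1 /\ phi t <= psi t].
have A0 : A 0.
  split; first by rewrite lexx.
  rewrite /psi mulr0 expR0 mul1r; have : 0 <= b / l by rewrite divr_ge0 // ltW.
  lra.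
have supA : has_sup A by split; [exists 0 | exists t1 => t [/andP[]]].
pose s := sup A.
have s0 : 0 <= s by apply: ub_le_sup => //; exact: supA.2.
have st1 : s <= t1 by apply: ge_sup; [exists 0 | move=> t [/andP[]]].
have sT : 0 <= s <= T by rewrite s0 (le_trans st1).
have after u : s < u -> u <= t1 -> psi u < phi u.
  move=> su ut1; rewrite ltNge; apply/negP => pu.
  have : A u by split=> //; rewrite (le_trans s0 (ltW su)).
  by move=> /(ub_le_sup supA.2); rewrite leNgt su.
have ps : phi s <= psi s.
  rewrite leNgt; apply/negP => gaps.
  have [|d d0 H] := gapc s sT (phi s - psi s); first by rewrite subr_gt0.
  have [a [/andP[a0 at1] pa] sa] := sup_adherent d0 supA.
  rewrite -/s in sa.
  have as_ : a <= s by apply: ub_le_sup; [exact: supA.2|split=> //; rewrite a0].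
  have aT : 0 <= a <= T by rewrite a0 (le_trans at1).
  have da : `|a - s| < d by rewrite ler0_norm; lra.
  have := H a aT da; rewrite ltr_norml => /andP[]; lra.
have st1' : s < t1.
  by rewrite lt_neqAle st1 andbT; apply/eqP => E; move: ps; rewrite E leNgt gap1.
have pick d : 0 < d -> exists h, [/\ 0 < h, h < d & h <= t1 - s].
  move=> d0; have m0 : 0 < Num.min d (t1 - s) by rewrite lt_min d0 subr_gt0.
  have : Num.min d (t1 - s) <= d by rewrite ge_min lexx.
  have : Num.min d (t1 - s) <= t1 - s by rewrite ge_min lexx orbT.
  by exists (Num.min d (t1 - s) / 2); split; lra.
(* the differential inequality excludes equality at [s], and continuity
   excludes strict inequality *)
have [eqs|nes] := eqVneq (phi s) (psi s).
  have s_gt0 : 0 < s.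
    rewrite lt_neqAle s0 andbT; apply/eqP => E; move: eqs.
    rewrite -E /psi mulr0 expR0 mul1r.
    have : 0 <= b / l by rewrite divr_ge0 // ltW.
    lra.
  have s0T : 0 < s < T by rewrite s_gt0 (lt_le_trans st1').
  have psB : phi s < B by rewrite eqs psiB.
  have [d d0 H] := pd s s0T psB (l * e1) (mulr_gt0 l0 e10).
  have [h [h0 hd ht]] := pick d d0.
  have hd' : 0 < h < d by rewrite h0.
  have := H h hd'.
  have := psi_step s h (ltW h0).
  have : psi (s + h) < phi (s + h) by apply: after; lra.
  rewrite eqs; lra.
have gaps : 0 < psi s - phi s by rewrite subr_gt0 lt_neqAle nes.
have [d d0 H] := gapc s sT _ gaps.
have [h [h0 hd ht]] := pick d d0.
have pu : psi (s + h) < phi (s + h) by apply: after; lra.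
have shT : 0 <= s + h <= T by apply/andP; split; lra.
have := H (s + h) shT; rewrite (_ : s + h - s = h); last by ring.
rewrite (gtr0_norm h0) hd => /(_ isT); rewrite ltr_norml => /andP[_].
lra.
Qed.

(** * Linear and quadratic estimates at frozen parameters *)

Lemma psd2 (R : realType) (x y z u v : R) : 0 <= x -> 0 <= z -> y ^+ 2 <= x * z ->
  0 <= x * u ^+ 2 - 2 * y * u * v + z * v ^+ 2.
Proof.
move=> x0 z0 yxz; have [x_eq0|x_neq0] := eqVneq x 0.
  move: yxz; rewrite x_eq0 mul0r => y0.
  have -> : y = 0 by apply/eqP; rewrite -sqrf_eq0 eq_le y0 sqr_ge0.
  by have := mulr_ge0 z0 (sqr_ge0 v); lra.
have xp : 0 < x by rewrite lt_neqAle eq_sym x_neq0.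
rewrite -(pmulr_rge0 _ xp).
have -> : x * (x * u ^+ 2 - 2 * y * u * v + z * v ^+ 2) =
  (x * u - y * v) ^+ 2 + (x * z - y ^+ 2) * v ^+ 2 by ring.
by rewrite addr_ge0 ?sqr_ge0 // mulr_ge0 ?sqr_ge0 // subr_ge0.
Qed.

(** The matrix [C K + A D - M] is symmetrised by the weights [gLR], [gRL].  The
    last three hypotheses say that [C K + A D - t M] is negative semidefinite for
    these weights; the remaining [- (1 - t) M] gives the definite part. *)
Lemma linear_part_form (R : realType)
    (aL aR gLR gRL mL mR dL dR A C t m L Rr : R) :
  0 < m -> m <= gLR -> m <= gRL -> m <= mL -> m <= mR -> t <= 1 ->
  C * aL + A * dL <= t * mL -> C * aR + A * dR <= t * mR ->
  (C * gRL) * (C * gLR) <=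
    (t * mL - (C * aL + A * dL)) * (t * mR - (C * aR + A * dR)) ->
  gLR * L * ((C * aL + A * dL - mL) * L + C * gRL * Rr) +
  gRL * Rr * (C * gLR * L + (C * aR + A * dR - mR) * Rr) <=
  - ((1 - t) * m ^+ 2 * (L ^+ 2 + Rr ^+ 2)).
Proof.
move=> m0 m1 m2 m3 m4 t1 H1 H2 H3.
have g1 : 0 < gLR by lra.
have g2 : 0 < gRL by lra.
have := @psd2 R (gLR * (t * mL - (C * aL + A * dL))) (C * gLR * gRL)
  (gRL * (t * mR - (C * aR + A * dR))) L Rr.
rewrite !mulr_ge0 ?subr_ge0 ?(ltW g1) ?(ltW g2) // => /(_ isT isT) H.
have {}H := H _.
have Hp : 0 <= gLR * gRL by rewrite mulr_ge0 // ltW.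
have /H {H3}H : (C * gLR * gRL) ^+ 2 <= gLR * (t * mL - (C * aL + A * dL)) *
    (gRL * (t * mR - (C * aR + A * dR))).
  have -> : (C * gLR * gRL) ^+ 2 = (gLR * gRL) * ((C * gRL) * (C * gLR)) by ring.
  have -> : gLR * (t * mL - (C * aL + A * dL)) * (gRL * (t * mR - (C * aR + A * dR))) =
    (gLR * gRL) * ((t * mL - (C * aL + A * dL)) * (t * mR - (C * aR + A * dR))) by ring.
  exact: ler_wpM2l.
have E1 : m ^+ 2 <= gLR * mL by rewrite expr2; apply: ler_pM => //; exact: ltW.
have E2 : m ^+ 2 <= gRL * mR by rewrite expr2; apply: ler_pM => //; exact: ltW.
have K1 : (1 - t) * m ^+ 2 * L ^+ 2 <= (1 - t) * (gLR * mL) * L ^+ 2.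
  by rewrite ler_wpM2r ?sqr_ge0 // ler_wpM2l // subr_ge0.
have K2 : (1 - t) * m ^+ 2 * Rr ^+ 2 <= (1 - t) * (gRL * mR) * Rr ^+ 2.
  by rewrite ler_wpM2r ?sqr_ge0 // ler_wpM2l // subr_ge0.
lra.
Qed.

Lemma young2 (R : realType) (u v w : R) : 0 < u ->
  2 * v * w <= u * v ^+ 2 + u^-1 * w ^+ 2.
Proof.
move=> u0; have ui : 0 <= u^-1 by rewrite invr_ge0 ltW.
have := mulr_ge0 ui (sqr_ge0 (u * v - w)).
have -> : u^-1 * (u * v - w) ^+ 2 = u * v ^+ 2 - 2 * v * w + u^-1 * w ^+ 2.
  by field; exact: lt0r_neq0.
lra.
Qed.

Lemma ler_mul_norm (R : realType) (u v p q : R) : `|u| <= p -> `|v| <= q ->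
  u * v <= p * q.
Proof.
move=> up vq; apply: le_trans (ler_norm _) _; rewrite normrM; exact: ler_pM.
Qed.

(** Decay of [gLR L^2 + gRL Rr^2 + k a^2] along the field with frozen
    parameters.  Here [A] and [C] are the values at the equilibrium, [L], [Rr]
    and [a] the deviations from it, [X] and [Y] the actual values.  The constant
    [k] is such that the coupling of [a] with [L], [Rr] costs at most half of the
    decay of [L], [Rr] given by the linear part, and [r] such that the terms of
    order three cost at most half of what is left. *)
Lemma frozen_decay (R : realType)
    (aL aR gLR gRL mL mR dL dR eta rho A C t m M k r L Rr a X Y : R) :
  0 < m -> m <= 1 -> 1 <= M -> t < 1 ->
  k = (1 - t) * m ^+ 3 / (9 * M ^+ 2) -> r = (1 - t) * m ^+ 2 / (28 * M ^+ 2) ->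
  r <= 1 ->
  [/\ m <= aL <= M, m <= aR <= M, m <= gLR <= M & m <= gRL <= M] ->
  [/\ m <= mL <= M, m <= mR <= M, m <= dL <= M & m <= dR <= M] ->
  m <= eta <= M -> m <= rho <= M ->
  0 <= A -> 0 <= C -> A + C = 1 -> eta * C = rho * A ->
  gLR * L * ((C * aL + A * dL - mL) * L + C * gRL * Rr) +
  gRL * Rr * (C * gLR * L + (C * aR + A * dR - mR) * Rr) <=
  - ((1 - t) * m ^+ 2 * (L ^+ 2 + Rr ^+ 2)) ->
  `|L| <= r -> `|Rr| <= r -> `|a| <= r ->
  X = A + a -> Y = 1 - (L + Rr) - X ->
  2 * gLR * L * ((Y * aL + X * dL - mL) * L + Y * gRL * Rr) +
  2 * gRL * Rr * (Y * gLR * L + (Y * aR + X * dR - mR) * Rr) +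
  2 * k * a * (eta * Y - X * (dL * L + dR * Rr) - rho * X) <=
  - (2 * k * m * (L ^+ 2 + Rr ^+ 2 + a ^+ 2)).
Proof.
move=> m0 m1 M1 t1 kE rE r1
  [/andP[aL1 aL2] /andP[aR1 aR2] /andP[gLR1 gLR2] /andP[gRL1 gRL2]]
  [/andP[mL1 mL2] /andP[mR1 mR2] /andP[dL1 dL2] /andP[dR1 dR2]]
  /andP[e1 e2] /andP[p1 p2]
  A0 C0 AC eC form Lr Rrr ar XE YE.
set l := `|L|; set q := `|Rr|; set n := `|a|.
have l0 : 0 <= l by exact: normr_ge0.
have q0 : 0 <= q by exact: normr_ge0.
have n0 : 0 <= n by exact: normr_ge0.
have LE : L ^+ 2 = l ^+ 2 by rewrite /l real_normK ?num_real.
have RE : Rr ^+ 2 = q ^+ 2 by rewrite /q real_normK ?num_real.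
have aE : a ^+ 2 = n ^+ 2 by rewrite /n real_normK ?num_real.
have M0 : 0 < M by lra.
have CE : C = 1 - A by rewrite -AC; ring.
have t0 : 0 < 1 - t by lra.
have k0 : 0 < k by rewrite kE divr_gt0 // mulr_gt0 // exprn_gt0.
have r0 : 0 <= r by apply: le_trans Lr.
pose s := - (L + Rr) - a.
have sr : `|s| <= 3 * r.
  apply: le_trans (ler_normB _ _) _; rewrite normrN.
  by have := ler_normD L Rr; lra.
have nM x : m <= x -> x <= M -> `|x| <= M by move=> h1 h2; rewrite ger0_norm //; lra.
(* [T1], [T2] and [T12] bound the terms of order three *)
have T1 : 2 * gLR * L * (s * (aL * L + gRL * Rr) + a * dL * L) <=
    2 * M ^+ 2 * r * (4 * l ^+ 2 + 3 * (l * q)).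
  have -> : 2 * M ^+ 2 * r * (4 * l ^+ 2 + 3 * (l * q)) =
    (2 * M * l) * ((3 * r) * (M * l + M * q) + r * M * l) by ring.
  apply: ler_mul_norm.
    by rewrite !normrM (@ger0_norm _ 2) // ler_wpM2r // ler_wpM2l // nM.
  apply: le_trans (ler_normD _ _) _; rewrite !normrM; apply: lerD.
    apply: ler_pM => //; apply: le_trans (ler_normD _ _) _; rewrite !normrM.
    by apply: lerD; rewrite ler_wpM2r // nM.
  by rewrite ler_wpM2r // ler_pM // nM.
have T2 : 2 * gRL * Rr * (s * (gLR * L + aR * Rr) + a * dR * Rr) <=
    2 * M ^+ 2 * r * (4 * q ^+ 2 + 3 * (l * q)).
  have -> : 2 * M ^+ 2 * r * (4 * q ^+ 2 + 3 * (l * q)) =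
    (2 * M * q) * ((3 * r) * (M * l + M * q) + r * M * q) by ring.
  apply: ler_mul_norm.
    by rewrite !normrM (@ger0_norm _ 2) // ler_wpM2r // ler_wpM2l // nM.
  apply: le_trans (ler_normD _ _) _; rewrite !normrM; apply: lerD.
    apply: ler_pM => //; apply: le_trans (ler_normD _ _) _; rewrite !normrM.
    by apply: lerD; rewrite ler_wpM2r // nM.
  by rewrite ler_wpM2r // ler_pM // nM.
have T12 : 2 * M ^+ 2 * r * (4 * l ^+ 2 + 3 * (l * q)) +
    2 * M ^+ 2 * r * (4 * q ^+ 2 + 3 * (l * q)) <= (1 - t) * m ^+ 2 / 2 * (l ^+ 2 + q ^+ 2).
  have -> : (1 - t) * m ^+ 2 / 2 * (l ^+ 2 + q ^+ 2) = 14 * M ^+ 2 * r * (l ^+ 2 + q ^+ 2).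
    by rewrite rE; field; exact: lt0r_neq0.
  have : 0 <= M ^+ 2 * r * (l - q) ^+ 2.
    by apply: mulr_ge0; [apply: mulr_ge0 => //|]; exact: sqr_ge0.
  lra.
(* [T3] to [T4] bound the contribution of [a], with [C = 1 - A] and the
   equilibrium equation *)
have T3 : a * (eta * Y - X * (dL * L + dR * Rr) - rho * X) <=
    - 2 * m * n ^+ 2 + 3 * M * (n * l + n * q).
  have -> : a * (eta * Y - X * (dL * L + dR * Rr) - rho * X) =
    - ((eta + rho) * a ^+ 2) + a * (- (eta * (L + Rr)) - X * (dL * L + dR * Rr)) +
    a * (eta * (1 - A) - rho * A) by rewrite YE XE; ring.
  have -> : eta * (1 - A) - rho * A = 0.
    by rewrite -eC CE subrr.
  rewrite mulr0 addr0 aE; apply: lerD.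
    have : 2 * m * n ^+ 2 <= (eta + rho) * n ^+ 2.
      rewrite ler_wpM2r ?sqr_ge0 //.
      by clear -e1 p1; lra.
    lra.
  have -> : 3 * M * (n * l + n * q) = n * (M * (l + q) + 2 * (M * l + M * q)) by ring.
  apply: ler_mul_norm => //; apply: le_trans (ler_normB _ _) _; rewrite normrN !normrM.
  apply: lerD; first by apply: ler_pM => //; [exact: nM|exact: ler_normD].
  apply: ler_pM => //.
    rewrite XE; apply: le_trans (ler_normD _ _) _; rewrite (ger0_norm A0); lra.
  apply: le_trans (ler_normD _ _) _; rewrite !normrM.
  by apply: lerD; rewrite ler_wpM2r // nM.
have T3' : 6 * M * (n * l + n * q) <= 2 * m * n ^+ 2 + 9 * M ^+ 2 / m * (l ^+ 2 + q ^+ 2).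
  have := @young2 R m n (3 * M * l) m0; have := @young2 R m n (3 * M * q) m0.
  have -> : m^-1 * (3 * M * l) ^+ 2 = 9 * M ^+ 2 / m * l ^+ 2 by ring.
  have -> : m^-1 * (3 * M * q) ^+ 2 = 9 * M ^+ 2 / m * q ^+ 2 by ring.
  lra.
have T4 : 2 * k * a * (eta * Y - X * (dL * L + dR * Rr) - rho * X) <=
    - 2 * k * m * n ^+ 2 + (1 - t) * m ^+ 2 * (l ^+ 2 + q ^+ 2).
  have -> : (1 - t) * m ^+ 2 * (l ^+ 2 + q ^+ 2) =
      k * (9 * M ^+ 2 / m * (l ^+ 2 + q ^+ 2)).
    by rewrite kE; field; rewrite !lt0r_neq0.
  have := ler_wpM2l (ltW k0) T3; have := ler_wpM2l (ltW k0) T3'.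
  lra.
have T5 : 2 * k * m * (l ^+ 2 + q ^+ 2) <= (1 - t) * m ^+ 2 / 2 * (l ^+ 2 + q ^+ 2).
  rewrite ler_wpM2r ?addr_ge0 ?sqr_ge0 //.
  have -> : 2 * k * m = (1 - t) * m ^+ 2 / 2 * (4 / 9 * (m ^+ 2 / M ^+ 2)).
    by rewrite kE; field; exact: lt0r_neq0.
  rewrite ler_piMr ?divr_ge0 ?mulr_ge0 ?sqr_ge0 ?(ltW t0) ?(ltW m0) //.
  have : m ^+ 2 / M ^+ 2 <= 1.
    rewrite ler_pdivrMr ?exprn_gt0 // mul1r; apply: lerXn2r;
      rewrite ?nnegrE ?(ltW m0) ?(ltW M0) //.
    exact: le_trans M1.
  lra.
have -> : 2 * gLR * L * ((Y * aL + X * dL - mL) * L + Y * gRL * Rr) =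
    2 * (gLR * L * ((C * aL + A * dL - mL) * L + C * gRL * Rr)) +
    2 * gLR * L * (s * (aL * L + gRL * Rr) + a * dL * L).
  by rewrite YE XE /s CE; ring.
have -> : 2 * gRL * Rr * (Y * gLR * L + (Y * aR + X * dR - mR) * Rr) =
    2 * (gRL * Rr * (C * gLR * L + (C * aR + A * dR - mR) * Rr)) +
    2 * gRL * Rr * (s * (gLR * L + aR * Rr) + a * dR * Rr).
  by rewrite YE XE /s CE; ring.
move: form; rewrite aE LE RE; lra.
Qed.

(** * The threshold condition *)

Lemma has_ubound_spectrum (R : realType) (n : nat) (B : 'M[R]_n) :
  has_ubound [set ComplexField.Normc.normc z | z in
        [set z : R[i] | eigenvalue (map_mx (real_complex R) B) z]].
Proof.
have [rs E] := closed_field_poly_normal (char_poly (map_mx (real_complex R) B)).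
exists (\sum_(y <- rs) ComplexField.Normc.normc y) => _ [z /= + <-].
rewrite eigenvalue_root_char E (monicP (char_poly_monic _)) scale1r root_prod_XsubC.
move=> zr; rewrite (big_rem z) //= lerDl sumr_ge0 // => y _.
by case: y => u v; exact: sqrtr_ge0.
Qed.

Lemma le_spectral_radius (R : realType) (n : nat) (B : 'M[R]_n) (v : 'rV[R]_n) (l : R) :
  v != 0 -> v *m B = l *: v -> `|l| <= spectral_radius B.
Proof.
move=> v0 vB; have -> : `|l| = ComplexField.Normc.normc (real_complex R l).
  by rewrite /= expr0n addr0 sqrtr_sqr.
apply: ub_le_sup; first exact: has_ubound_spectrum.
exists (real_complex R l) => //=; apply/eigenvalueP.
exists (map_mx (real_complex R) v); last by rewrite map_mx_eq0.
by rewrite -map_mxM vB map_mxZ.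
Qed.

(** A real 2x2 matrix with diagonal [a], [d] and off-diagonal entries [b, c > 0]
    has the real eigenvalue [l = (a + d + sqrt ((a - d)^2 + 4 b c)) / 2], which is
    at least [a] and [d], and satisfies [(l - a) (l - d) = b c]. *)
Lemma spectral_radius2 (R : realType) (B : 'M[R]_2) (t : R) :
  0 < B 0 1 -> 0 < B 1 0 -> spectral_radius B <= t ->
  [/\ B 0 0 <= t, B 1 1 <= t & B 0 1 * B 1 0 <= (t - B 0 0) * (t - B 1 1)].
Proof.
set a := B 0 0; set b := B 0 1; set c := B 1 0; set d := B 1 1 => b0 c0 Bt.
pose D := Num.sqrt ((a - d) ^+ 2 + 4 * (b * c)).
have bc0 : 0 < b * c by rewrite mulr_gt0.
have D2 : D ^+ 2 = (a - d) ^+ 2 + 4 * (b * c).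
  by rewrite sqr_sqrtr // addr_ge0 ?sqr_ge0 // mulr_ge0 // ltW.
have Dad : `|a - d| <= D.
  by rewrite -sqrtr_sqr ler_wsqrtr // lerDl mulr_ge0 // ltW.
have {Dad} [D1 D3] : a - d <= D /\ d - a <= D.
  by move: Dad; rewrite ler_norml => /andP[]; lra.
pose l := (a + d + D) / 2.
have lE : (l - a) * (l - d) = b * c.
  have -> : (l - a) * (l - d) = (D ^+ 2 - (a - d) ^+ 2) / 4 by rewrite /l; field.
  by rewrite D2; field.
have lt : l <= t.
  apply: le_trans Bt; apply: le_trans (ler_norm _) _.
  apply: (@le_spectral_radius _ _ _ (\row_j [:: c; l - a]`_j)).
    apply/eqP => /rowP/(_ 0); rewrite !mxE /= => cE.
    by move: c0; rewrite cE ltxx.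
  apply/rowP => j; rewrite !mxE big_ord_recl big_ord1 !mxE /=.
  have -> : lift ord0 ord0 = 1 :> 'I_2 by apply/val_inj.
  case: (unliftP 0 j) => [k ->|->]; rewrite ?(ord1 k) /=.
    have -> : lift 0 0 = 1 :> 'I_2 by apply/val_inj.
    rewrite /= -/b -/d; have : l * (l - a) = b * c + d * (l - a) by rewrite -lE; ring.
    lra.
  rewrite -/a -/c; ring.
have la : a <= l by rewrite /l; lra.
have ld : d <= l by rewrite /l; lra.
split; [lra|lra|]; rewrite -lE; apply: ler_pM; lra.
Qed.

(** The condition [R_LA p <= t], freed of the inverse of [Mmx p]: the matrix
    [t M - (Cdag K + Adag D)] has nonnegative diagonal and determinant. *)
Lemma R_LA_entries (R : realType) (p : 'rV[R]_10) (t : R) :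
  (forall i, 0 < p 0 i) -> R_LA p <= t ->
  [/\ Cdag p * alphaL p + Adag p * deltaL p <= t * muL p,
      Cdag p * alphaR p + Adag p * deltaR p <= t * muR p &
  (Cdag p * gammaRL p) * (Cdag p * gammaLR p) <=
    (t * muL p - (Cdag p * alphaL p + Adag p * deltaL p)) *
    (t * muR p - (Cdag p * alphaR p + Adag p * deltaR p))].
Proof.
move=> p0; rewrite /R_LA; set N := Cdag p *: _ + _; set B := invmx _ *m N => Bt.
have C0 : 0 < Cdag p by rewrite divr_gt0 ?addr_gt0 ?p0.
have mL : 0 < muL p by exact: p0.
have mR : 0 < muR p by exact: p0.
have MU : Mmx p \in unitmx.
  rewrite unitmxE det_diag unitfE big_ord_recl big_ord1 !mxE /=.
  by rewrite mulf_neq0 // gt_eqF.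
have MB : Mmx p *m B = N by rewrite mulKVmx.
have ent i j : [:: muL p; muR p]`_(val i) * B i j = N i j.
  by rewrite -MB /Mmx mul_diag_mx !mxE.
have n00 : N 0 0 = Cdag p * alphaL p + Adag p * deltaL p.
  by rewrite !mxE /= mulr1n.
have n01 : N 0 1 = Cdag p * gammaRL p.
  by rewrite !mxE /= mulr0n mulr0 addr0.
have n10 : N 1 0 = Cdag p * gammaLR p.
  by rewrite !mxE /= mulr0n mulr0 addr0.
have n11 : N 1 1 = Cdag p * alphaR p + Adag p * deltaR p.
  by rewrite !mxE /= mulr1n.
have [] := @spectral_radius2 R B t _ _ Bt.
- have := ent 0 1; rewrite n01 /= => h; rewrite -(pmulr_rgt0 _ mL) h.
  by rewrite mulr_gt0 // p0.
- have := ent 1 0; rewrite n10 /= => h; rewrite -(pmulr_rgt0 _ mR) h.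
  by rewrite mulr_gt0 // p0.
have /= e00 := ent 0 0; have /= e01 := ent 0 1; have /= e10 := ent 1 0; have /= e11 := ent 1 1.
rewrite -n00 -n01 -n10 -n11 -e00 -e01 -e10 -e11 => h1 h2 h3; split.
- by rewrite mulrC ler_wpM2r // ltW.
- by rewrite mulrC ler_wpM2r // ltW.
- have -> : muL p * B 0 1 * (muR p * B 1 0) = muL p * muR p * (B 0 1 * B 1 0) by ring.
  have -> : (t * muL p - muL p * B 0 0) * (t * muR p - muR p * B 1 1) =
    muL p * muR p * ((t - B 0 0) * (t - B 1 1)) by ring.
  by rewrite ler_wpM2l // mulr_ge0 // ltW.
Qed.

(** * The Lyapunov function *)

Lemma compact_box (R : realType) (n : nat) (P : set 'rV[R]_n) :
  compact P -> P !=set0 -> (forall p, P p -> forall i, 0 < p 0 i) ->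
  exists m M : R, [/\ 0 < m, m <= 1, 1 <= M &
    forall p, P p -> forall i, m <= p 0 i <= M].
Proof.
move=> Pc P0 Ppos.
have cc i : {within P, continuous (fun p : 'rV[R]_n => p 0 i)}.
  by apply: continuous_subspaceT => x; exact: coord_continuous.
have /choice[lo Hlo] : forall i, exists l : R, 0 < l /\ forall p, P p -> l <= p 0 i.
  move=> i; have [c /[!inE] Pc' H] := compact_EVT_min P0 Pc (cc i).
  by exists (c 0 i); split=> [|p Pp]; [exact: Ppos|apply: H; rewrite inE].
have /choice[hi Hhi] : forall i, exists u : R, 0 < u /\ forall p, P p -> p 0 i <= u.
  move=> i; have [c /[!inE] Pc' H] := compact_EVT_max P0 Pc (cc i).
  by exists (c 0 i); split=> [|p Pp]; [exact: Ppos|apply: H; rewrite inE].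
have slo : 0 <= \sum_i (lo i)^-1.
  by apply: sumr_ge0 => i _; rewrite invr_ge0 ltW //; have [] := Hlo i.
have shi : 0 <= \sum_i hi i.
  by apply: sumr_ge0 => i _; rewrite ltW //; have [] := Hhi i.
exists (1 + \sum_i (lo i)^-1)^-1, (1 + \sum_i hi i); split.
- by rewrite invr_gt0; lra.
- by rewrite invf_le1; lra.
- lra.
move=> p Pp i; have [l0 Hl] := Hlo i; have [u0 Hu] := Hhi i; apply/andP; split.
  apply: le_trans (Hl p Pp); rewrite -[leRHS]invrK lef_pV2 ?posrE ?invr_gt0 //.
    rewrite (bigD1 i) //=.
    have : 0 <= \sum_(j | j != i) (lo j)^-1.
      by apply: sumr_ge0 => j _; rewrite invr_ge0 ltW //; have [] := Hlo j.
    lra.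
  lra.
apply: le_trans (Hu p Pp) _; rewrite (bigD1 i) //=.
have : 0 <= \sum_(j | j != i) hi j.
  by apply: sumr_ge0 => j _; rewrite ltW //; have [] := Hhi j.
lra.
Qed.

(** Squared Euclidean distance to the radical-free equilibrium. *)
Definition dist2 (R : realType) (x : 'rV[R]_3) (p : 'rV[R]_10) : R :=
  x 0 0 ^+ 2 + x 0 1 ^+ 2 + (x 0 2 - Adag p) ^+ 2.

(** The quadratic Lyapunov function; the weight [k] of the last coordinate will
    be a small constant. *)
Definition lyap (R : realType) (k : R) (x : 'rV[R]_3) (p : 'rV[R]_10) : R :=
  gammaLR p * x 0 0 ^+ 2 + gammaRL p * x 0 1 ^+ 2 + k * (x 0 2 - Adag p) ^+ 2.

(** Derivative of [lyap k (_) p] at [x] in the direction [v]. *)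
Definition dlyap (R : realType) (k : R) (x v : 'rV[R]_3) (p : 'rV[R]_10) : R :=
  2 * gammaLR p * x 0 0 * v 0 0 + 2 * gammaRL p * x 0 1 * v 0 1 +
  2 * k * (x 0 2 - Adag p) * v 0 2.

Lemma sum3 (R : realType) (F : 'I_3 -> R) : \sum_i F i = F 0 + F 1 + F 2.
Proof.
rewrite !big_ord_recl big_ord0 addr0 addrA.
by congr (F _ + F _ + F _); apply/val_inj.
Qed.

Lemma enorm_dist2 (R : realType) (x : 'rV[R]_3) (p : 'rV[R]_10) :
  enorm (x - xdag p) ^+ 2 = dist2 x p.
Proof.
rewrite /enorm sqr_sqrtr; last by apply: sumr_ge0 => i _; exact: sqr_ge0.
by rewrite sum3 !mxE /= !subr0.
Qed.

Lemma vector_field0 (R : realType) (x : 'rV[R]_3) (p : 'rV[R]_10) :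
  vector_field x p 0 0 =
  ((1 - (x 0 0 + x 0 1) - x 0 2) * alphaL p + x 0 2 * deltaL p - muL p) * x 0 0 +
  (1 - (x 0 0 + x 0 1) - x 0 2) * gammaRL p * x 0 1.
Proof.
rewrite /vector_field !mxE /= !(big_ord_recl, big_ord0) !mxE /=.
rewrite ?(big_ord_recl, big_ord0, mxE) /= ?mulr1n ?mulr0n; ring.
Qed.

Lemma vector_field1 (R : realType) (x : 'rV[R]_3) (p : 'rV[R]_10) :
  vector_field x p 0 1 =
  (1 - (x 0 0 + x 0 1) - x 0 2) * gammaLR p * x 0 0 +
  ((1 - (x 0 0 + x 0 1) - x 0 2) * alphaR p + x 0 2 * deltaR p - muR p) * x 0 1.
Proof.
rewrite /vector_field !mxE /= !(big_ord_recl, big_ord0) !mxE /=.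
rewrite ?(big_ord_recl, big_ord0, mxE) /= ?mulr1n ?mulr0n; ring.
Qed.

Lemma vector_field2 (R : realType) (x : 'rV[R]_3) (p : 'rV[R]_10) :
  vector_field x p 0 2 =
  Defs.eta p * (1 - (x 0 0 + x 0 1) - x 0 2) -
  x 0 2 * (deltaL p * x 0 0 + deltaR p * x 0 1) - Defs.rho p * x 0 2.
Proof.
rewrite /vector_field !mxE /= !(big_ord_recl, big_ord0) !mxE /=.
rewrite ?(big_ord_recl, big_ord0, mxE) /= ?mulr1n ?mulr0n; ring.
Qed.

Lemma AdagCdag (R : realType) (p : 'rV[R]_10) : 0 < Defs.eta p -> 0 < Defs.rho p ->
  [/\ 0 <= Adag p, 0 <= Cdag p, Adag p + Cdag p = 1 &
      Defs.eta p * Cdag p = Defs.rho p * Adag p].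
Proof.
move=> e0 r0; have s0 : Defs.eta p + Defs.rho p != 0 by rewrite gt_eqF // addr_gt0.
by split; rewrite /Adag /Cdag ?divr_ge0 ?addr_ge0 ?(ltW e0) ?(ltW r0) //; field.
Qed.

(** Uniform decay at frozen parameters, in the ball of radius [r] around the
    equilibrium. *)
Lemma dlyap_vector_field (R : realType) (nu m M k r : R) (x : 'rV[R]_3)
    (p : 'rV[R]_10) :
  0 < m -> m <= 1 -> 1 <= M -> 0 < nu ->
  k = nu * m ^+ 3 / (9 * M ^+ 2) -> r = nu * m ^+ 2 / (28 * M ^+ 2) -> r <= 1 ->
  (forall i, m <= p 0 i <= M) -> R_LA p <= 1 - nu -> dist2 x p <= r ^+ 2 ->
  0 <= r ->
  dlyap k x (vector_field x p) p <= - (2 * k * m * dist2 x p).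
Proof.
move=> m0 m1 M1 nu0 kE rE r1 box Rp dr r0.
have p0 i : 0 < p 0 i by have /andP[h _] := box i; exact: lt_le_trans m0 h.
have [A0 C0 AC eC] := AdagCdag (p0 8) (p0 9).
have lo i : m <= p 0 i by have /andP[] := box i.
have [h1 h2 h3] := R_LA_entries p0 Rp.
have t1 : 1 - nu <= 1 by lra.
have form := linear_part_form (x 0 0) (x 0 1) m0 (lo 2) (lo 3) (lo 4) (lo 5) t1 h1 h2 h3.
have cr y : y ^+ 2 <= dist2 x p -> `|y| <= r.
  by move=> h; rewrite -ler_sqr ?nnegrE // real_normK ?num_real //; exact: le_trans dr.
have Lr : `|x 0 0| <= r.
  by apply: cr; rewrite /dist2 -addrA lerDl addr_ge0 ?sqr_ge0.
have Rr : `|x 0 1| <= r.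
  by apply: cr; rewrite /dist2 addrAC lerDr addr_ge0 ?sqr_ge0.
have ar : `|x 0 2 - Adag p| <= r.
  by apply: cr; rewrite /dist2 lerDr addr_ge0 ?sqr_ge0.
rewrite /dlyap vector_field0 vector_field1 vector_field2 /dist2.
apply: (@frozen_decay R (alphaL p) (alphaR p) (gammaLR p) (gammaRL p) (muL p)
  (muR p) (deltaL p) (deltaR p) (Defs.eta p) (Defs.rho p) (Adag p) (Cdag p) (1 - nu) m M k r) => //.
- lra.
- by rewrite kE; congr (_ * _ / _); ring.
- by rewrite rE; congr (_ * _ / _); ring.
- by split; exact: box.
- by split; exact: box.
- exact: box.
- exact: box.
- ring.
Qed.

Lemma Adag_lip (R : realType) (m d : R) (p q : 'rV[R]_10) :
  0 < m -> (forall i, m <= p 0 i) -> (forall i, m <= q 0 i) -> 0 <= d ->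
  (forall i, `|q 0 i - p 0 i| <= d) -> `|Adag q - Adag p| <= d / m.
Proof.
move=> m0 mp mq d0 qp.
have := mp 8; have := mp 9; have := mq 8; have := mq 9; have := qp 8; have := qp 9.
rewrite /Adag /Defs.eta /Defs.rho; set e := p 0 8; set f := q 0 8; set g := p 0 9; set h := q 0 9.
move=> hg fe h0 f0 g0 e0.
have s1 : 0 < e + g by lra.
have s2 : 0 < f + h by lra.
have -> : f / (f + h) - e / (e + g) =
    ((f - e) * g - e * (h - g)) / ((e + g) * (f + h)).
  by field; rewrite !gt_eqF.
rewrite normrM normfV (gtr0_norm (mulr_gt0 s1 s2)).
rewrite ler_pdivrMr ?mulr_gt0 //.
apply: (@le_trans _ _ (d * (e + g))).
  apply: le_trans (ler_normB _ _) _; rewrite !normrM mulrDr addrC; apply: lerD.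
    by rewrite mulrC ler_pM // ger0_norm //; lra.
  by rewrite ler_pM // ger0_norm //; lra.
have -> : d / m * ((e + g) * (f + h)) = d * (e + g) * ((f + h) / m) by field; lra.
rewrite ler_peMr ?mulr_ge0 ?(ltW s1) // ler_pdivlMr //; lra.
Qed.

(** Variation of the Lyapunov function under a change of the parameters. *)
Lemma lyap_drift (R : realType) (m k d : R) (x : 'rV[R]_3) (p q : 'rV[R]_10) :
  0 < m -> 0 <= k -> (forall i, m <= p 0 i) -> (forall i, m <= q 0 i) -> 0 <= d ->
  (forall i, `|q 0 i - p 0 i| <= d) ->
  lyap k x q <= lyap k x p + d * (x 0 0 ^+ 2 + x 0 1 ^+ 2) +
    k * (d / m * (2 * `|x 0 2 - Adag p| + d / m)).
Proof.
move=> m0 k0 mp mq d0 qp; have Ad := Adag_lip m0 mp mq d0 qp.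
rewrite /lyap; set a := x 0 2 - Adag p; set s := Adag q - Adag p.
have -> : x 0 2 - Adag q = a - s by rewrite /a /s; ring.
have E1 : (gammaLR q - gammaLR p) * x 0 0 ^+ 2 <= d * x 0 0 ^+ 2.
  by rewrite ler_wpM2r ?sqr_ge0 //; exact: le_trans (ler_norm _) (qp _).
have E2 : (gammaRL q - gammaRL p) * x 0 1 ^+ 2 <= d * x 0 1 ^+ 2.
  by rewrite ler_wpM2r ?sqr_ge0 //; exact: le_trans (ler_norm _) (qp _).
have E3 : (a - s) ^+ 2 <= a ^+ 2 + d / m * (2 * `|a| + d / m).
  have -> : (a - s) ^+ 2 = a ^+ 2 + (- s) * (2 * a - s) by ring.
  rewrite lerD2l; apply: le_trans (ler_norm _) _; rewrite normrM normrN ler_pM //.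
  by apply: le_trans (ler_normB _ _) _; rewrite normrM (@ger0_norm _ 2) // lerD2l.
have := ler_wpM2l k0 E3; lra.
Qed.

(** * Estimates along a slowly driven trajectory *)

Lemma is_derive_coord (R : realType) (n : nat) (x : R -> 'rV[R]_n) (t : R)
    (v : 'rV[R]_n) (i : 'I_n) :
  is_derive t 1 x v -> is_derive t 1 (fun s => x s 0 i) (v 0 i).
Proof.
move=> [dx <-]; apply: DeriveDef; first by move/derivable_mxP: dx; apply.
by rewrite (derive_mx dx) mxE.
Qed.

Lemma is_derive_right_le (R : realType) (G : R -> R) (t w : R) :
  is_derive t 1 G w -> forall e, 0 < e -> exists2 d, 0 < d &
    forall h, 0 < h < d -> G (t + h) <= G t + h * (w + e).
Proof.
move=> /is_derive1_caratheodory[g [gE gc gt]] e e0.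
move/cvgrPdist_lt: gc => /(_ e e0)[d /= d0 H]; exists d => // h /andP[h0 hd].
have := gE (t + h); rewrite (_ : t + h - t = h); last by ring.
have := H (t + h); rewrite /= opprD addNKr normrN gtr0_norm // => /(_ hd).
rewrite gt distrC ltr_norml => /andP[_ gh] GE.
have : h * (g (t + h) - w) <= h * e by rewrite ler_wpM2l ?ltW.
lra.
Qed.

Lemma is_derive_lyap (R : realType) (k t : R) (x : R -> 'rV[R]_3) (v : 'rV[R]_3)
    (p : 'rV[R]_10) : is_derive t 1 x v ->
  is_derive t 1 (fun s => lyap k (x s) p) (dlyap k (x t) v p).
Proof.
move=> dx.
have d0 := is_derive_coord 0 dx; have d1 := is_derive_coord 1 dx.
have d2 := is_derive_coord 2 dx.
have -> : (fun s => lyap k (x s) p) =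
    gammaLR p *: ((fun s => x s 0 0) ^+ 2) + gammaRL p *: ((fun s => x s 0 1) ^+ 2) +
    k *: (((fun s => x s 0 2) + cst (- Adag p)) ^+ 2).
  by apply/funext => s; rewrite /lyap !fctE.
have d3 := is_deriveD d2 (is_derive_cst (- Adag p) t 1).
have D := is_deriveD
  (is_deriveD (is_deriveZ (gammaLR p) (is_deriveX 2 d0))
              (is_deriveZ (gammaRL p) (is_deriveX 2 d1)))
  (is_deriveZ k (is_deriveX 2 d3)).
apply: (is_derive_eq D).
rewrite /dlyap /GRing.scale /= !fctE /= addr0 !expr1; ring.
Qed.

Section lyapunov_estimate.
Context {R : realType} (m M nu k r eps T : R).
Hypotheses (m0 : 0 < m) (m1 : m <= 1) (M1 : 1 <= M) (nu0 : 0 < nu) (nu1 : nu < 1).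
Hypothesis kE : k = nu * m ^+ 3 / (9 * M ^+ 2).
Hypothesis rE : r = nu * m ^+ 2 / (28 * M ^+ 2).
Hypotheses (eps0 : 0 < eps) (epsk : eps <= k * m / 2).
Context (th : R -> 'rV[R]_10) (x : R -> 'rV[R]_3).
Hypothesis th_box : forall t, 0 <= t <= T -> forall i, m <= th t 0 i <= M.
Hypothesis th_sub : forall t, 0 <= t <= T -> R_LA (th t) <= 1 - nu.
Hypothesis th_lip : forall i s t, 0 <= s -> s <= t -> t <= T ->
  `|th t 0 i - th s 0 i| <= eps * (t - s).
Hypothesis xc : {within `[0, T], continuous x}.
Hypothesis dx : forall t, 0 < t < T -> is_derive t 1 x (vector_field (x t) (th t)).

Local Notation phi t := (lyap k (x t) (th t)).

Let M0 : 0 < M. Proof. exact: lt_le_trans M1. Qed.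
Let k0 : 0 < k. Proof. by rewrite kE divr_gt0 // mulr_gt0 // exprn_gt0. Qed.
Let r0 : 0 < r. Proof. by rewrite rE divr_gt0 // mulr_gt0 // exprn_gt0. Qed.

Let num2 : nu * m ^+ 2 <= 1.
Proof.
by apply: mulr_ile1; rewrite ?exprn_ge0 ?(ltW nu0) ?(ltW nu1) ?exprn_ile1 ?(ltW m0).
Qed.

Let km : k <= m.
Proof.
rewrite kE ler_pdivrMr ?mulr_gt0 ?exprn_gt0 //.
have -> : nu * m ^+ 3 = m * (nu * m ^+ 2) by ring.
rewrite ler_wpM2l ?(ltW m0) //.
have := num2.
have : 1 <= M ^+ 2 by rewrite exprn_ege1.
lra.
Qed.

Let r1 : r <= 1.
Proof.
rewrite rE ler_pdivrMr ?mulr_gt0 ?exprn_gt0 // mul1r.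
have := num2.
have : 1 <= M ^+ 2 by rewrite exprn_ege1.
lra.
Qed.

Lemma lyap_ge t : 0 <= t <= T -> k * dist2 (x t) (th t) <= phi t.
Proof.
move=> tT; rewrite /lyap /dist2.
have /andP[g1 _] := th_box tT 2; have /andP[g2 _] := th_box tT 3.
have : k * x t 0 0 ^+ 2 <= gammaLR (th t) * x t 0 0 ^+ 2.
  by rewrite ler_wpM2r ?sqr_ge0 // (le_trans km).
have : k * x t 0 1 ^+ 2 <= gammaRL (th t) * x t 0 1 ^+ 2.
  by rewrite ler_wpM2r ?sqr_ge0 // (le_trans km).
lra.
Qed.

Lemma lyap_le t : 0 <= t <= T -> phi t <= M * dist2 (x t) (th t).
Proof.
move=> tT; rewrite /lyap /dist2.
have /andP[_ g1] := th_box tT 2; have /andP[_ g2] := th_box tT 3.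
have : gammaLR (th t) * x t 0 0 ^+ 2 <= M * x t 0 0 ^+ 2.
  by rewrite ler_wpM2r ?sqr_ge0.
have : gammaRL (th t) * x t 0 1 ^+ 2 <= M * x t 0 1 ^+ 2.
  by rewrite ler_wpM2r ?sqr_ge0.
have : k * (x t 0 2 - Adag (th t)) ^+ 2 <= M * (x t 0 2 - Adag (th t)) ^+ 2.
  by rewrite ler_wpM2r ?sqr_ge0 // (le_trans km) // (le_trans m1).
lra.
Qed.

Let phi_cont t : 0 <= t <= T -> forall e, 0 < e -> exists2 d, 0 < d &
     forall s, 0 <= s <= T -> `|s - t| < d -> `|phi s - phi t| < e.
Proof.
move=> tT e e0.
have tI : `[0, T]%classic t by rewrite /= in_itv.
have cx i : x s 0 i @[s --> within `[0, T] (nbhs t)] --> x t 0 i.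
  have /subspace_continuousP/(_ t tI) cxt := xc.
  apply: (@continuous_cvg _ _ _ _ _ x (fun M : 'rV[R]_3 => M 0 i) (x t)) => //.
  exact: coord_continuous.
have cth i : th s 0 i @[s --> within `[0, T] (nbhs t)] --> th t 0 i.
  apply/cvgrPdist_lt => z z0; rewrite near_withinE.
  exists (z / eps); first by rewrite /= divr_gt0.
  move=> s /= std; rewrite in_itv /= => sT.
  have [t0 tT'] := andP tT; have [s0 sT'] := andP sT.
  have zE : z = eps * (z / eps) by field; exact: lt0r_neq0.
  case: (leP s t) => [st|/ltW ts].
    apply: le_lt_trans (th_lip i s0 st tT') _; rewrite [ltRHS]zE ltr_pM2l //.
    exact: le_lt_trans (ler_norm _) std.
  rewrite distrC; apply: le_lt_trans (th_lip i t0 ts sT') _.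
  rewrite [ltRHS]zE ltr_pM2l //; rewrite distrC in std.
  exact: le_lt_trans (ler_norm _) std.
have es : Defs.eta (th t) + Defs.rho (th t) != 0.
  have /andP[h8 _] := th_box tT 8; have /andP[h9 _] := th_box tT 9.
  by rewrite gt_eqF // addr_gt0 // (lt_le_trans m0).
have cA : Adag (th s) @[s --> within `[0, T] (nbhs t)] --> Adag (th t).
  by apply: cvgM; [exact: cth | apply: cvgV => //; apply: cvgD; exact: cth].
have cphi : phi s @[s --> within `[0, T] (nbhs t)] --> phi t.
  rewrite /lyap; under eq_fun do rewrite !expr2; rewrite !expr2.
  apply: cvgD; [apply: cvgD|]; apply: cvgM.
  - exact: cth.
  - by apply: cvgM; exact: cx.
  - exact: cth.
  - by apply: cvgM; exact: cx.
  - exact: cvg_cst.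
  - by apply: cvgM; (apply: cvgB; [exact: cx | exact: cA]).
move/cvgrPdist_lt: cphi => /(_ e e0); rewrite near_withinE => -[d /= d0 H].
exists d => // s sT sd; rewrite distrC; apply: H => /=; last by rewrite in_itv.
by rewrite distrC.
Qed.


Lemma coord_cvg t i : 0 < t < T -> x s 0 i @[s --> t] --> x t 0 i.
Proof.
move=> tT; have [d _] := is_derive_coord i (dx tT).
exact/differentiable_continuous/derivable1_diffP.
Qed.

(** Differential inequality for the right difference quotients of the Lyapunov
    function, inside the ball of radius [r]. *)
Lemma lyap_dini t : 0 < t < T -> phi t < k * r ^+ 2 ->
  forall e, 0 < e -> exists2 d, 0 < d & forall h, 0 < h < d ->
    phi (t + h) <= phi t + h * (- (k * m / M) * phi t + 2 * k / m ^+ 3 * eps ^+ 2 + e).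
Proof.
move=> tT phir e e0; have /andP[t0 tT'] := tT.
have tT2 : 0 <= t <= T by rewrite !ltW.
have e20 : 0 < e / 2 by rewrite divr_gt0.
pose a s := x s 0 2 - Adag (th t).
(* for [s > t], [(s - t) * Q s] bounds the effect of the change of the
   parameters between [t] and [s] *)
pose Q s := eps * (x s 0 0 ^+ 2 + x s 0 1 ^+ 2) +
  k * (eps / m * (2 * `|a s| + eps / m * (s - t))).
have [d1 d10 H1] := is_derive_right_le (is_derive_lyap k (th t) (dx tT)) e20.
have cQ : Q s @[s --> t] --> Q t.
  have cx i : x s 0 i @[s --> t] --> x t 0 i by exact: coord_cvg.
  rewrite /Q; under eq_fun do rewrite !expr2; rewrite !expr2.
  apply: cvgD; apply: cvgM; [exact: cvg_cst| |exact: cvg_cst|].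
    by apply: cvgD; apply: cvgM; exact: cx.
  apply: cvgM; first exact: cvg_cst.
  apply: cvgD; apply: cvgM; [exact: cvg_cst| |exact: cvg_cst|].
    by apply: cvg_norm; apply: cvgB; [exact: cx|exact: cvg_cst].
  by apply: cvgB; [exact: cvg_id|exact: cvg_cst].
move/cvgrPdist_lt: cQ => /(_ _ e20)[d2 /= d20 H2].
exists (Num.min (Num.min d1 d2) (T - t)).
  by rewrite !lt_min d10 d20 subr_gt0.
move=> h; rewrite !lt_min => /andP[h0 /andP[/andP[hd1 hd2] hT]].
have thT : 0 <= t + h <= T by apply/andP; split; lra.
have h0' := ltW h0.
have lip i : `|th (t + h) 0 i - th t 0 i| <= eps * h.
  have -> : eps * h = eps * (t + h - t) by ring.
  by apply: th_lip; lra.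
have loT i : m <= th t 0 i by have /andP[] := th_box tT2 i.
have loH i : m <= th (t + h) 0 i by have /andP[] := th_box thT i.
have D := lyap_drift (x (t + h)) m0 (ltW k0) loT loH (mulr_ge0 (ltW eps0) h0') lip.
have {}H1 : lyap k (x (t + h)) (th t) <=
    phi t + h * (dlyap k (x t) (vector_field (x t) (th t)) (th t) + e / 2).
  by apply: H1; rewrite h0.
have {}H2 : Q (t + h) <= Q t + e / 2.
  have := H2 (t + h); rewrite /= opprD addNKr normrN gtr0_norm // => /(_ hd2).
  by rewrite distrC ltr_norml => /andP[_]; lra.
have {H1} {}D : phi (t + h) <=
    phi t + h * (dlyap k (x t) (vector_field (x t) (th t)) (th t) + e / 2) + h * Q (t + h).
  apply: le_trans D _; rewrite -addrA lerD // le_eqVlt; apply/orP; left; apply/eqP.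
  by rewrite /Q /a (_ : t + h - t = h); [field; exact: lt0r_neq0|ring].
apply: le_trans D _; rewrite -addrA lerD2l -mulrDr ler_wpM2l //.
have dr : dist2 (x t) (th t) <= r ^+ 2.
  by rewrite -(ler_pM2l k0); apply: le_trans (lyap_ge tT2) (ltW phir).
have V := dlyap_vector_field m0 m1 M1 nu0 kE rE r1 (th_box tT2) (th_sub tT2) dr (ltW r0).
have Y := @young2 R (k * m / 2) `|a t| (k * eps / m) _.
(* the motion of the equilibrium costs a quarter of the decay of [a], up to a
   multiple of [eps^2] *)
have {Y} : 2 * `|a t| * (k * eps / m) <=
    k * m / 2 * a t ^+ 2 + 2 * k / m ^+ 3 * eps ^+ 2.
  apply: le_trans (Y _) _; first by rewrite divr_gt0 // mulr_gt0.
  rewrite real_normK ?num_real // lerD2l le_eqVlt; apply/orP; left; apply/eqP.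
  by field; rewrite !lt0r_neq0.
have : Q t = eps * (x t 0 0 ^+ 2 + x t 0 1 ^+ 2) + 2 * `|a t| * (k * eps / m).
  by rewrite /Q subrr; field; exact: lt0r_neq0.
have : eps * (x t 0 0 ^+ 2 + x t 0 1 ^+ 2) <= k * m / 2 * (x t 0 0 ^+ 2 + x t 0 1 ^+ 2).
  by rewrite ler_wpM2r // addr_ge0 ?sqr_ge0.
have : k * m / M * phi t <= k * m * dist2 (x t) (th t).
  have -> : k * m * dist2 (x t) (th t) = k * m / M * (M * dist2 (x t) (th t)).
    by field; exact: lt0r_neq0.
  by rewrite ler_wpM2l ?lyap_le // divr_ge0 ?mulr_ge0 // ltW.
have : 0 <= k * m * dist2 (x t) (th t).
  by rewrite !mulr_ge0 ?(ltW k0) ?(ltW m0) // !addr_ge0 ?sqr_ge0.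
move: V H2; rewrite /dist2 -/(a t); lra.
Qed.

(** Exponential decay of the Lyapunov function up to a term of order [eps^2]. *)
Lemma lyap_bound : 0 < T ->
  phi 0 + 2 * k / m ^+ 3 * eps ^+ 2 / (k * m / M) < k * r ^+ 2 ->
  forall t, 0 <= t <= T ->
    phi t <= expR (- (k * m / M) * t) * phi 0 +
      2 * k / m ^+ 3 * eps ^+ 2 / (k * m / M).
Proof.
move=> T0 small; have T0' : (0 : R) <= 0 <= T by apply/andP; split=> //; exact: ltW.
apply: (@dini_comparison _ _ _ _ _ (fun t => phi t)) small phi_cont lyap_dini.
- by rewrite divr_gt0 // mulr_gt0.
- by rewrite mulr_ge0 ?sqr_ge0 // divr_ge0 ?exprn_ge0 ?mulr_ge0 // ltW.
- apply: le_trans (lyap_ge T0'); rewrite mulr_ge0 ?(ltW k0) //.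
  by rewrite !addr_ge0 ?sqr_ge0.
Qed.

End lyapunov_estimate.

(** * Tracking of the radical-free branch *)

Lemma enorm_ge0 (R : realType) (n : nat) (x : 'rV[R]_n) : 0 <= enorm x.
Proof. exact: sqrtr_ge0. Qed.

Theorem theorem4p2 (R : realType) (P : set 'rV[R]_10)
    (P_compact : compact P) (P_convex : convex_set P)
    (P_pos : forall p, P p -> forall i, 0 < p 0 i)
    (nu : R) (nu01 : 0 < nu < 1) (P_nonempty : subcritical P nu !=set0) :
  exists r eps_nu lam c : R,
    [/\ 0 < r, 0 < eps_nu, 0 < lam & 0 < c] /\
    forall (T : R) (theta : R -> 'rV[R]_10) (eps : R)
           (x0 : 'rV[R]_3) (x : R -> 'rV[R]_3),
      0 < T ->
      (forall t, 0 <= t <= T -> subcritical P nu (theta t)) ->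
      absolutely_continuous 0 T theta ->
      0 < eps <= eps_nu ->
      (ess_speed T theta <= eps%:E)%E ->
      state_space x0 ->
      is_solution T theta x0 x ->
      enorm (x0 - xdag (theta 0)) <= r / (2 * c) ->
      eps <= r / (2 * c) ->
      (forall t, 0 <= t <= T ->
         enorm (x t - xdag (theta t)) <=
           c * expR (- lam * t) * enorm (x0 - xdag (theta 0)) + c * eps) /\
      (forall t, 0 <= t <= T -> enorm (x t - xdag (theta t)) <= r).
Proof.
have [nu0 nu1] := andP nu01.
have P0 : P !=set0 by case: P_nonempty => p [Pp _]; exists p.
have [m [M [m0 m1 M1 box]]] := compact_box P_compact P0 P_pos.
have M0 : 0 < M by exact: lt_le_trans M1.
pose k := nu * m ^+ 3 / (9 * M ^+ 2).
pose r := nu * m ^+ 2 / (28 * M ^+ 2).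
have k0 : 0 < k by rewrite divr_gt0 // mulr_gt0 // exprn_gt0.
have r0 : 0 < r by rewrite divr_gt0 // mulr_gt0 // exprn_gt0.
pose l := k * m / M.
have l0 : 0 < l by rewrite divr_gt0 // mulr_gt0.
pose b := 2 / m ^+ 3 / l.
have b0 : 0 < b by apply: divr_gt0 => //; rewrite divr_gt0 // exprn_gt0.
have Mk0 : 0 < M / k by rewrite divr_gt0.
(* [c] exceeds 1, the ratio [M / k] of the two comparison constants, and the
   coefficient [b] of [eps^2] in the limit of [dist2] *)
pose c := 1 + M / k + b.
have c1 : 1 <= c by rewrite /c; lra.
have c0 : 0 < c by lra.
have Mkc : M <= k * c.
  have -> : M = k * (M / k) by field; exact: lt0r_neq0.
  by rewrite ler_pM2l // /c; lra.
have bkc : k * b <= k * c by rewrite ler_pM2l // /c; lra.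
exists r, (k * m / 2), (l / 2), c; split.
  by split=> //; rewrite divr_gt0 // mulr_gt0.
move=> T th eps x0 x T0 th_sub acth /andP[eps0 epsk] spd _ [x00 xc dx] E0r epsr.
have th_lip := ess_speed_lipschitz T0 (ltW eps0) acth spd.
have th_box t : 0 <= t <= T -> forall i, m <= th t 0 i <= M.
  by move=> /th_sub[/box].
have th_R t : 0 <= t <= T -> R_LA (th t) <= 1 - nu by move=> /th_sub[].
have T0' : (0 : R) <= 0 <= T by apply/andP; split=> //; exact: ltW.
set E0 := enorm (x0 - xdag (th 0)) in E0r *.
have E00 : 0 <= E0 by exact: enorm_ge0.
have phi0 : lyap k (x 0) (th 0) <= k * c * E0 ^+ 2.
  apply: le_trans (lyap_le m0 m1 M1 nu0 nu1 erefl x th_box T0') _.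
  by rewrite x00 -enorm_dist2 ler_wpM2r ?sqr_ge0.
have bE : 2 * k / m ^+ 3 * eps ^+ 2 / l = k * b * eps ^+ 2.
  by rewrite /b; field; rewrite !lt0r_neq0.
have beps : k * b * eps ^+ 2 <= k * c * eps ^+ 2 by rewrite ler_wpM2r ?sqr_ge0.
have sq y : 0 <= y -> y <= r / (2 * c) -> k * c * y ^+ 2 <= k * r ^+ 2 / 4.
  move=> y0 yr; rewrite -[leLHS]mulrA -[leRHS]mulrA ler_pM2l //.
  have c2y : c * y <= r / 2.
    have -> : r / 2 = c * (r / (2 * c)) by field; exact: lt0r_neq0.
    by rewrite ler_pM2l.
  apply: (@le_trans _ _ ((c * y) ^+ 2)).
    by rewrite exprMn [c ^+ 2]expr2 -mulrA ler_peMl // mulr_ge0 ?sqr_ge0 // ltW.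
  have -> : r ^+ 2 / 4 = (r / 2) ^+ 2 by field.
  by rewrite ler_sqr ?nnegrE ?divr_ge0 ?mulr_ge0 // ltW.
(* the initial data keep the comparison solution inside the ball *)
have small : lyap k (x 0) (th 0) + 2 * k / m ^+ 3 * eps ^+ 2 / l < k * r ^+ 2.
  have := sq _ E00 E0r; have := sq _ (ltW eps0) epsr.
  have : 0 < k * r ^+ 2 by rewrite mulr_gt0 // exprn_gt0.
  by rewrite bE; lra.
have main t : 0 <= t <= T ->
    enorm (x t - xdag (th t)) <= c * expR (- (l / 2) * t) * E0 + c * eps.
  move=> tT.
  have := lyap_bound m0 m1 M1 nu0 nu1 erefl erefl eps0 epsk th_box th_R th_lip xc dx T0 small tT.
  have := lyap_ge m0 m1 M1 nu0 nu1 erefl x th_box tT.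
  rewrite -/k -/l bE => ge le.
  have e2 : expR (- l * t) = expR (- (l / 2) * t) ^+ 2.
    by rewrite expr2 -expRD; congr expR; field.
  set z := expR (- (l / 2) * t) in e2 *.
  have z0 : 0 <= z by exact: expR_ge0.
  rewrite -ler_sqr ?nnegrE ?enorm_ge0 //; last first.
    by rewrite addr_ge0 ?mulr_ge0 // ltW.
  rewrite enorm_dist2 -(ler_pM2l k0); apply: le_trans ge _; apply: le_trans le _.
  rewrite e2.
  have h1 : z ^+ 2 * lyap k (x 0) (th 0) <= z ^+ 2 * (k * c * E0 ^+ 2).
    by rewrite ler_wpM2l ?sqr_ge0.
  (* [c (u^2 + v^2) <= (c u + c v)^2], as [1 <= c] *)
  have h2 : k * (c * ((z * E0) ^+ 2 + eps ^+ 2)) <= k * (c * z * E0 + c * eps) ^+ 2.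
    rewrite ler_pM2l //.
    have -> : (c * z * E0 + c * eps) ^+ 2 =
      c * c * ((z * E0) ^+ 2 + eps ^+ 2) + 2 * c * c * (z * E0 * eps) by ring.
    have h3 : 0 <= 2 * c * c * (z * E0 * eps) by rewrite !mulr_ge0 // ltW.
    have h4 : c * ((z * E0) ^+ 2 + eps ^+ 2) <= c * (c * ((z * E0) ^+ 2 + eps ^+ 2)).
      by rewrite ler_pM2l // ler_peMl // addr_ge0 ?sqr_ge0.
    lra.
  lra.
split=> // t tT; apply: le_trans (main t tT) _.
have z1 : expR (- (l / 2) * t) <= 1.
  have /andP[t0 _] := tT.
  by rewrite -expR0 ler_expR mulNr oppr_le0 mulr_ge0 // divr_ge0 // ltW.
have h1 : c * expR (- (l / 2) * t) * E0 <= c * E0.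
  by rewrite ler_wpM2r // ger_pMr.
have h2 y : y <= r / (2 * c) -> c * y <= r / 2.
  move=> yr; have -> : r / 2 = c * (r / (2 * c)) by field; exact: lt0r_neq0.
  by rewrite ler_pM2l.
have := h2 _ E0r; have := h2 _ epsr; lra.
Qed.
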